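(* Let $\Gamma$ be a closed, countable, discrete subgroup of a second countable, locally compact abelian Hausdorff group $G$, admitting an injective endomorphism $\alpha:\Gamma\to\Gamma$ with $\Gamma/\alpha(\Gamma)$ finite of order $N>1$ and with dual endomorphism $\alpha^\ast(\chi)=\chi\circ\alpha$ ergodic for the normalized Haar measure $\lambda$ on $\widehat\Gamma$. Let $\mathcal H$ be a separable Hilbert space and $\pi:\Gamma\to\mathcal U(\mathcal H)$ a unitary representation with spectral data $(\mu,(\sigma_i)_i,T)$, $\mu\ll\lambda$. Let $V\subset\mathcal H$ be a $\pi$-invariant closed subspace and let $J_V$ be the range function associated with $V$ through $T$. Let $\widetilde\pi:\Gamma\to\mathcal U(V)$ be the subrepresentation of $\pi$ on $V$, with spectral data $(\widetilde\mu,(\widetilde\sigma_i)_i,\widetilde T)$ and multiplicity function $\widetilde m$, and let $\widetilde J$ be the range function associated with $V$ through $\widetilde T$. Then for $\widetilde\mu$-almost all $\chi\in\widehat\Gamma$, $$\widetilde m(\chi)=\dim\widetilde J(\chi)\le\dim J_V(\chi).$$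
   Context: A closed subspace $V\subset\mathcal H$ is $\pi$-invariant if $\pi(\gamma)V\subset V$ for all $\gamma\in\Gamma$; the subrepresentation on $V$ is $\widetilde\pi(\gamma)=\pi(\gamma)|_V$. Spectral data of a unitary representation $\rho$ of $\Gamma$ on a separable Hilbert space $\mathcal K$: a finite Borel measure $\mu$ on $\widehat\Gamma$ (unique up to equivalence), nested Borel sets $\cdots\subset\sigma_2\subset\sigma_1\subset\widehat\Gamma$ (unique up to $\mu$-null sets), and a unitary operator $T:\mathcal K\to\bigoplus_i L^2(\sigma_i,\mu)$ with $[T(\rho(\gamma)f)]_i(\chi)=(\gamma,\chi)[Tf]_i(\chi)$ for all $i$, $\gamma\in\Gamma$, $f\in\mathcal K$, $\mu$-a.e. $\chi$, where $(\gamma,\chi)$ is the value of $\chi$ at $\gamma$, and intertwining the projection valued measure of $\rho$ with multiplication by indicator functions of Borel sets. The multiplicity function is $m(\chi)=\sum_i I_{\sigma_i}(\chi)\in\{0,1,\dots,+\infty\}$. When $\mu\ll\lambda$, $\mu$ is taken to be the restriction of $\lambda$ to $\sigma_1$. The measure $\widetilde\mu$ of a subrepresentation is absolutely continuous with respect to $\mu$. Since $\Gamma$ is countably infinite, an enumeration of $\Gamma$ is fixed and $\bigoplus_i L^2(\sigma_i,\mu)$ is regarded as a subspace of $L^2(\widehat\Gamma,\ell^2(\Gamma),\mu)$, the Hilbert space of square integrable $\ell^2(\Gamma)$-valued functions. A range function is a map $J:\widehat\Gamma\to\{\text{closed subspaces of }\ell^2(\Gamma)\}$, measurable if $\chi\mapsto(P(\chi)a,b)$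 is measurable for all $a,b\in\ell^2(\Gamma)$, $P(\chi)$ being the orthogonal projection onto $J(\chi)$; range functions equal a.e. are identified. Put $M_J=\{F\in L^2(\widehat\Gamma,\ell^2(\Gamma),\mu):F(\chi)\in J(\chi)\ \mu\text{-a.e.}\}$. The range function $J_V$ is the (unique up to $\mu$-a.e. equality) measurable range function with $T(V)=M_{J_V}$; equivalently, for any at most countable $\mathscr A$ with $V=\overline{\operatorname{span}}\{\pi(\gamma)\varphi:\gamma\in\Gamma,\varphi\in\mathscr A\}$, $J_V(\chi)=\overline{\operatorname{span}}\{T\varphi(\chi):\varphi\in\mathscr A\}$ $\mu$-a.e. Likewise $\widetilde J$ is the one with $\widetilde T(V)=M_{\widetilde J}$ (with $\widetilde\mu$ in place of $\mu$). Dimensions take values in $\{0,1,\dots,+\infty\}$. *)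

(* Defs.v *)
From HB Require Import structures.
From mathcomp Require Import all_boot all_order all_algebra.
From mathcomp Require Import complex ring lra.
From mathcomp Require Import all_classical all_reals all_analysis.

Set Implicit Arguments.
Unset Strict Implicit.
Unset Printing Implicit Defensive.

Import Order.TTheory GRing.Theory Num.Theory Num.Def.
Import numFieldNormedType.Exports.

Local Open Scope classical_set_scope.
Local Open Scope ring_scope.

Section unconditional_sum.
Variables (R : realType) (I : choiceType).

Definition rsummable (f : I -> R) : Prop := summable [set: I] (EFin \o f).

(* A junk value unless f is summable. *)
Definition rsum (f : I -> R) : R :=
  fine (\esum_(i in [set: I]) (Num.max (f i) 0)%:E) -
  fine (\esum_(i in [set: I]) (Num.max (- f i) 0)%:E).

Definition csum (f : I -> R[i]) : R[i] :=
  Complex (rsum (fun i => complex.Re (f i))) (rsum (fun i => complex.Im (f i))).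

Lemma rsummable_le (f g : I -> R) :
  (forall i, `|f i| <= `|g i|) -> rsummable g -> rsummable f.
Proof.
move=> fg; apply: le_lt_trans; apply: le_esum => i _ /=.
by rewrite lee_fin.
Qed.

Lemma rsummableD (f g : I -> R) :
  rsummable f -> rsummable g -> rsummable (fun i => f i + g i).
Proof. by move=> sf sg; exact: (summableD sf sg). Qed.

Lemma rsummableN (f : I -> R) : rsummable f -> rsummable (fun i => - f i).
Proof. by move=> sf; apply: rsummable_le sf => i; rewrite normrN. Qed.

Lemma esumZ_ge0 (c : R) (f : I -> R) : 0 <= c -> (forall i, 0 <= f i) ->
  (\esum_(i in [set: I]) (c * f i)%:E = c%:E * \esum_(i in [set: I]) (f i)%:E)%E.
Proof.
move=> c0 f0; have [->|cn0] := eqVneq c 0.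
  by rewrite mul0e esum1// => i _; rewrite mul0r.
have cp : 0 < c by rewrite lt_def cn0.
have H (d : R) (g : I -> R) : 0 < d -> (forall i, 0 <= g i) ->
    (\esum_(i in [set: I]) (d * g i)%:E <=
     d%:E * \esum_(i in [set: I]) (g i)%:E)%E.
  move=> d0 g0; apply: ge_ereal_sup => _ [X [finX _] <-].
  under eq_fsbigr do rewrite EFinM.
  rewrite -ge0_mule_fsumr; last by move=> i; rewrite lee_fin.
  by rewrite lee_pmul2l//; apply: esum_ge; exists X.
apply/eqP; rewrite eq_le H//=.
have := H c^-1 (fun i => c * f i); rewrite invr_gt0 => /(_ cp).
move=> /(_ (fun i => mulr_ge0 c0 (f0 i))).
rewrite (@eq_esum _ _ _ _ (fun i => (f i)%:E)); last first.
  by move=> i _; rewrite mulrA mulVf// mul1r.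
move=> h; rewrite -(@lee_pmul2l _ c^-1%:E) ?lte_fin ?invr_gt0//.
by rewrite muleA -EFinM mulVf// mul1e.
Qed.

Lemma rsummableZ (c : R) (f : I -> R) :
  rsummable f -> rsummable (fun i => c * f i).
Proof.
rewrite /rsummable /summable => sf.
rewrite (@eq_esum _ _ _ _ (fun i => (`|c| * `|f i|)%:E)); last first.
  by move=> i _ /=; rewrite normrM.
rewrite esumZ_ge0//; have := sf.
have : (0 <= \esum_(i in [set: I]) `|(EFin \o f) i|)%E by exact: esum_ge0.
rewrite [X in (0 <= X)%E -> (X < _)%E -> _](@eq_esum _ _ _ _ (fun i => `|f i|%:E))//.
by case: (\esum_(i in _) _)%E => //= r _ _; rewrite -EFinM ltry.
Qed.

Lemma esum_fin_num (f : I -> R) : (forall i, 0 <= f i) -> rsummable f ->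
  \esum_(i in [set: I]) (f i)%:E \is a fin_num.
Proof.
move=> f0; rewrite /rsummable summableE (@eq_esum _ _ _ _ (fun i => (f i)%:E))//.
by move=> i _ /=; rewrite ger0_norm.
Qed.

Lemma rsum_diff (f g h : I -> R) :
  (forall i, 0 <= g i) -> (forall i, 0 <= h i) ->
  rsummable g -> rsummable h -> (forall i, f i = g i - h i) ->
  rsum f = fine (\esum_(i in [set: I]) (g i)%:E) -
           fine (\esum_(i in [set: I]) (h i)%:E).
Proof.
move=> g0 h0 sg sh fE.
have sf : rsummable f.
  have -> : f = (fun i => g i + - h i) by apply/funext => i; rewrite fE.
  by apply: rsummableD => //; exact: rsummableN.
have p0 i : 0 <= Num.max (f i) 0 by rewrite le_max lexx orbT.
have n0 i : 0 <= Num.max (- f i) 0 by rewrite le_max lexx orbT.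
have sp : rsummable (fun i => Num.max (f i) 0).
  apply: rsummable_le sf => i; rewrite (ger0_norm (p0 i)) ge_max normr_ge0.
  by rewrite ler_norm.
have sn : rsummable (fun i => Num.max (- f i) 0).
  apply: rsummable_le sf => i; rewrite (ger0_norm (n0 i)) ge_max normr_ge0.
  by rewrite andbT -normrN ler_norm.
have H : (\esum_(i in [set: I]) (Num.max (f i) 0)%:E +
          \esum_(i in [set: I]) (h i)%:E =
          \esum_(i in [set: I]) (Num.max (- f i) 0)%:E +
          \esum_(i in [set: I]) (g i)%:E)%E.
  rewrite -!esumD; last 4 first.
  - by move=> i _; rewrite lee_fin.
  - by move=> i _; rewrite lee_fin.
  - by move=> i _; rewrite lee_fin.
  - by move=> i _; rewrite lee_fin.
  apply: eq_esum => i _; rewrite -!EFinD; congr EFin.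
  have := fE i; case: (leP 0 (f i)) => [f0|f0] fiE.
    rewrite max_r ?oppr_le0// fiE; ring.
  rewrite max_l ?oppr_ge0; last exact: ltW.
  rewrite fiE; ring.
have /(congr1 fine) := H; rewrite !fineD ?esum_fin_num// => H'.
rewrite /rsum; apply/eqP; rewrite subr_eq addrAC eq_sym subr_eq H' addrC.
by [].
Qed.

Lemma rsum_ge0E (f : I -> R) : (forall i, 0 <= f i) -> rsummable f ->
  rsum f = fine (\esum_(i in [set: I]) (f i)%:E).
Proof.
move=> f0 sf; rewrite (@rsum_diff f f (fun=> 0))//; last first.
  by move=> i; rewrite subr0.
  by rewrite /rsummable /summable esum1 ?ltry// => i _ /=; rewrite normr0.
by rewrite [X in _ - fine X]esum1// subr0.
Qed.

Let p0 (u : I -> R) i : 0 <= Num.max (u i) 0.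
Proof. by rewrite le_max lexx orbT. Qed.

Let m0 (u : I -> R) i : 0 <= Num.max (- u i) 0.
Proof. by rewrite le_max lexx orbT. Qed.

Let sp (u : I -> R) : rsummable u -> rsummable (fun i => Num.max (u i) 0).
Proof.
apply: rsummable_le => i; rewrite (ger0_norm (p0 _ i)) ge_max normr_ge0.
by rewrite ler_norm.
Qed.

Let sm (u : I -> R) : rsummable u -> rsummable (fun i => Num.max (- u i) 0).
Proof. by move=> su; exact: (sp (rsummableN su)). Qed.

Lemma rsumD (f g : I -> R) : rsummable f -> rsummable g ->
  rsum (fun i => f i + g i) = rsum f + rsum g.
Proof.
move=> sf sg.
have pE (u : I -> R) i : u i = Num.max (u i) 0 - Num.max (- u i) 0.
  case: (leP 0 (u i)) => u0; first by rewrite max_r ?oppr_le0// subr0.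
  by rewrite max_l ?oppr_ge0 ?(ltW u0)// sub0r opprK.
rewrite (@rsum_diff _ (fun i => Num.max (f i) 0 + Num.max (g i) 0)
   (fun i => Num.max (- f i) 0 + Num.max (- g i) 0)); last 5 first.
- by move=> i; rewrite addr_ge0.
- by move=> i; rewrite addr_ge0.
- by apply: rsummableD; exact: sp.
- by apply: rsummableD; exact: sm.
- by move=> i; rewrite {1}(pE f) {1}(pE g); ring.
have H (u v : I -> R) : (forall i, 0 <= u i) -> (forall i, 0 <= v i) ->
    rsummable u -> rsummable v ->
    fine (\esum_(i in [set: I]) (u i + v i)%:E) =
    fine (\esum_(i in [set: I]) (u i)%:E) +
    fine (\esum_(i in [set: I]) (v i)%:E).
  move=> u0 v0 su sv; rewrite -fineD ?esum_fin_num// -esumD// => i _;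
  by rewrite lee_fin.
rewrite (H _ _ (p0 f) (p0 g) (sp sf) (sp sg)).
by rewrite (H _ _ (m0 f) (m0 g) (sm sf) (sm sg)) /rsum; ring.
Qed.

Lemma rsumN (f : I -> R) : rsum (fun i => - f i) = - rsum f.
Proof. by rewrite /rsum opprB; under [in X in _ - X]eq_esum do rewrite opprK. Qed.

Lemma rsumZ (c : R) (f : I -> R) : rsummable f ->
  rsum (fun i => c * f i) = c * rsum f.
Proof.
wlog c0 : c / 0 <= c => [hw|].
  have [c0|c0] := leP 0 c; first exact: hw.
  move=> sf; have := hw (- c); rewrite oppr_ge0 (ltW c0) => /(_ isT sf).
  rewrite mulNr => /(congr1 -%R); rewrite opprK => <-; rewrite -rsumN.
  by congr rsum; apply/funext => i; rewrite mulNr opprK.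
move=> sf.
have mE (x : R) : Num.max (c * x) 0 = c * Num.max x 0.
  by rewrite maxr_pMr// mulr0.
rewrite /rsum; under eq_esum do rewrite mE.
under [in X in _ - X]eq_esum do rewrite -mulrN mE.
by rewrite !esumZ_ge0// !fineM ?mulrBr// esum_fin_num//; [exact: sm|exact: sp].
Qed.

End unconditional_sum.

Section dot_triangle.
Variables (C : numClosedFieldType) (U : lmodType C) (dot : {dot U for conjC}).

Lemma dot_CauchySchwarz (u v : U) :
  `|dot u v| ^+ 2 <= dot u u * dot v v.
Proof.
have [->|v0] := eqVneq v 0.
  by rewrite [dot u 0]linear0r [dot 0 0]linear0r normr0 expr0n mulr0.
have vv0 : 0 < dot v v by rewrite dnorm_gt0.
have := dnorm_ge0 dot (dot v v *: u - dot u v *: v).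
have e : dot (dot v v *: u) (dot u v *: v) =
    dot v v * ((dot u v)^* * dot u v).
  by rewrite linearZl_LR linearZr_LR.
rewrite dnormB !dnormZ e !rmorphM /= conjCK (geC0_conj (ltW vv0)).
rewrite (ger0_norm (ltW vv0)) normCK.
set x := dot v v; set y := dot u u; set z := dot u v.
have -> : x ^+ 2 * y + z * z^* * x - (x * (z^* * z) + x * (z * z^*)) =
  x * (x * y - z * z^*) by ring.
by rewrite pmulr_rge0// subr_ge0 [x * y]mulrC.
Qed.

Lemma dot_triangle (u v : U) :
  sqrtC (dot (u + v) (u + v)) <= sqrtC (dot u u) + sqrtC (dot v v).
Proof.
rewrite -ler_sqr ?nnegrE ?addr_ge0 ?sqrtC_ge0 ?dnorm_ge0//.
rewrite sqrrD !sqrtCK dnormD [leRHS]addrAC lerD2l.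
set d := dot u v.
have sd : `|d| <= sqrtC (dot u u) * sqrtC (dot v v).
  rewrite -ler_sqr ?nnegrE ?mulr_ge0 ?sqrtC_ge0 ?dnorm_ge0//.
  by rewrite exprMn !sqrtCK dot_CauchySchwarz.
have -> : d + d^* = 'Re d *+ 2 by rewrite ReE -mulr_natr divfK.
rewrite lerMn2r /=; apply: le_trans sd.
exact: leif_Re_Creal.
Qed.
End dot_triangle.

Section ell2_def.
Variables (R : realType) (I : choiceType).

Definition square_summable : {pred I -> R[i]} := fun a =>
  `[< (\esum_(i in [set: I]) (complex.Re (`|a i| ^+ 2))%:E < +oo)%E >].

Record ell2 := Ell2 {
  ell2_fun :> I -> R[i] ;
  ell2P : ell2_fun \in square_summable }.

HB.instance Definition _ := [isSub for ell2_fun].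
HB.instance Definition _ := [Choice of ell2 by <:].

Let sqE (z : R[i]) :
  complex.Re (`|z| ^+ 2) = complex.Re z ^+ 2 + complex.Im z ^+ 2.
Proof. by case: z => x y; rewrite normCKC /=; ring. Qed.

Let sq_ge0 (z : R[i]) : 0 <= complex.Re (`|z| ^+ 2).
Proof. by rewrite sqE addr_ge0 ?sqr_ge0. Qed.

Let sq_summableP (a : I -> R[i]) : a \in square_summable <->
  rsummable (fun i => complex.Re (`|a i| ^+ 2)).
Proof.
rewrite unfold_in /square_summable; split.
- move=> /asboolW; apply: le_lt_trans; apply: le_esum => i _ /=.
  by rewrite lee_fin ger0_norm ?sq_ge0.
- move=> h; apply/asboolP; apply: le_lt_trans h; apply: le_esum => i _ /=.
  by rewrite lee_fin ler_norm.
Qed.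

Fact square_summable_submod : submod_closed square_summable.
Proof.
split.
  apply/sq_summableP; rewrite /rsummable /summable esum1 ?ltry// => i _.
  rewrite /comp sqE (_ : (0 : I -> R[i]) i = 0)// !raddf0.
  by rewrite !expr0n addr0 abse0.
move=> c u v /sq_summableP su /sq_summableP sv; apply/sq_summableP.
have := rsummableD (rsummableZ (2 * complex.Re (`|c| ^+ 2)) su)
                   (rsummableZ 2 sv).
apply: rsummable_le => i; rewrite [leLHS]ger0_norm ?sq_ge0//.
rewrite [leRHS]ger0_norm ?addr_ge0 ?mulr_ge0 ?sq_ge0//.
rewrite !fctE !sqE; case: c => c1 c2; case: (u i) => u1 u2.
case: (v i) => v1 v2 /=.
rewrite -subr_ge0.
have -> : 2 * (c1 ^+ 2 + c2 ^+ 2) * (u1 ^+ 2 + u2 ^+ 2) +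
  2 * (v1 ^+ 2 + v2 ^+ 2) - ((c1 * u1 - c2 * u2 + v1) ^+ 2 +
  (c1 * u2 + c2 * u1 + v2) ^+ 2) =
  (c1 * u1 - c2 * u2 - v1) ^+ 2 + (c1 * u2 + c2 * u1 - v2) ^+ 2 by ring.
by rewrite addr_ge0 ?sqr_ge0.
Qed.

HB.instance Definition _ :=
  GRing.isSubmodClosed.Build R[i] (I -> R[i]) square_summable
    square_summable_submod.
HB.instance Definition _ := [SubChoice_isSubLmodule of ell2 by <:].

Definition ell2_dot (a b : ell2) : R[i] := csum (fun i => a i * (b i)^*).

Let ell2_summable (a : ell2) : rsummable (fun i => complex.Re (`|a i| ^+ 2)).
Proof. exact/sq_summableP/ell2P. Qed.

Let dot_summable (a b : ell2) :
  rsummable (fun i => complex.Re (a i * (b i)^*)) /\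
  rsummable (fun i => complex.Im (a i * (b i)^*)).
Proof.
have s := rsummableD (ell2_summable a) (ell2_summable b).
have H (x1 x2 y1 y2 : R) :
    `|x1 * y1 + x2 * y2| <= x1 ^+ 2 + x2 ^+ 2 + (y1 ^+ 2 + y2 ^+ 2).
  have := sqr_ge0 (x1 + y1); have := sqr_ge0 (x1 - y1).
  have := sqr_ge0 (x2 + y2); have := sqr_ge0 (x2 - y2).
  have := sqr_ge0 x1; have := sqr_ge0 x2; have := sqr_ge0 y1.
  have := sqr_ge0 y2; rewrite !sqrrB !sqrrD ler_norml => *.
  by apply/andP; split; lra.
split; apply: rsummable_le s => i;
  rewrite [leRHS](ger0_norm (addr_ge0 (sq_ge0 _) (sq_ge0 _))) !sqE;
  case: (a i) => a1 a2; case: (b i) => b1 b2 /=.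
  by rewrite mulrN opprK; exact: H.
by rewrite [b1 ^+ 2 + _]addrC -(sqrrN b2); exact: H.
Qed.

Let csumDZ (c : R[i]) (f g : I -> R[i]) :
  rsummable (fun i => complex.Re (f i)) ->
  rsummable (fun i => complex.Im (f i)) ->
  rsummable (fun i => complex.Re (g i)) ->
  rsummable (fun i => complex.Im (g i)) ->
  csum (fun i => c * f i + g i) = c * csum f + csum g.
Proof.
case: c => c1 c2 rf if_ rg ig.
have rZ := rsummableZ; have rD := @rsummableD R I.
have E1 : (fun i => complex.Re (Complex c1 c2 * f i + g i)) = (fun i =>
    (c1 * complex.Re (f i) + - c2 * complex.Im (f i)) + complex.Re (g i)).
  by apply/funext => i; case: (f i) => x y; case: (g i) => z t /=; ring.
have E2 : (fun i => complex.Im (Complex c1 c2 * f i + g i)) = (fun i =>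
    (c1 * complex.Im (f i) + c2 * complex.Re (f i)) + complex.Im (g i)).
  by apply/funext => i; case: (f i) => x y; case: (g i) => z t /=; ring.
rewrite /csum E1 E2.
rewrite (rsumD (rD _ _ (rZ _ _ c1 _ rf) (rZ _ _ (- c2) _ if_)) rg).
rewrite (rsumD (rZ _ _ c1 _ rf) (rZ _ _ (- c2) _ if_)).
rewrite (rsumD (rD _ _ (rZ _ _ c1 _ if_) (rZ _ _ c2 _ rf)) ig).
rewrite (rsumD (rZ _ _ c1 _ if_) (rZ _ _ c2 _ rf)) !rsumZ//.
by apply/eqP; rewrite eq_complex /=; apply/andP; split; apply/eqP; ring.
Qed.

Let ell2_dot_linearl b : GRing.linear_for *%R (ell2_dot^~ b).
Proof.
move=> c u v; have [ru iu] := dot_summable u b.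
have [rv iv] := dot_summable v b.
rewrite /ell2_dot -csumDZ//; congr csum; apply/funext => i.
by rewrite mulrA -mulrDl.
Qed.

Let ell2_dot_herm (a b : ell2) : ell2_dot a b = (ell2_dot b a)^*.
Proof.
rewrite /ell2_dot /csum /=; congr Complex.
  congr rsum; apply/funext => i.
  by case: (a i) => ? ?; case: (b i) => ? ? /=; ring.
rewrite -rsumN; congr rsum; apply/funext => i.
by case: (a i) => ? ?; case: (b i) => ? ? /=; ring.
Qed.

Let ell2_dot_bilinear : bilinear_for *%R (conjC \; *%R) ell2_dot.
Proof.
split=> [b|a]; first exact: ell2_dot_linearl.
move=> c u v; rewrite ell2_dot_herm ell2_dot_linearl rmorphD rmorphM /=.
by rewrite -!ell2_dot_herm.
Qed.

HB.instance Definition _ := bilinear_isBilinear.Build R[i] ell2 ell2 R[i]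
  *%R (conjC \; *%R) ell2_dot ell2_dot_bilinear.

Let ell2_dot_hermitian (a b : ell2) :
  ell2_dot a b = (-1) ^+ false * conjC (ell2_dot b a).
Proof. by rewrite expr0 mul1r ell2_dot_herm. Qed.

HB.instance Definition _ := isHermitianSesquilinear.Build R[i] ell2 false conjC
  ell2_dot ell2_dot_hermitian.

Let ell2_dot_gt0 (a : ell2) : a != 0 -> 0 < ell2_dot a a.
Proof.
move=> a0.
have -> : ell2_dot a a =
    (rsum (fun i => complex.Re (`|a i| ^+ 2)))%:C%C.
  rewrite /ell2_dot /csum; congr Complex.
    congr rsum; apply/funext => i; rewrite sqE; case: (a i) => ? ? /=; ring.
  rewrite (_ : (fun _ => _) = fun=> 0 * 0).
    by rewrite rsumZ ?mul0r// /rsummable /summable esum1 ?ltry// => ? _ /=; rewrite normr0.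
  by apply/funext => i; case: (a i) => ? ? /=; ring.
have [j aj0] : exists j, a j != 0.
  apply: contrapT => /forallNP h; move/negP: a0; apply.
  apply/eqP/val_inj/funext => i; apply: contrapT => /eqP; exact: h.
rewrite ltcR rsum_ge0E// fine_gt0//; apply/andP; split; last first.
  by rewrite ltey_eq esum_fin_num.
apply: (@lt_le_trans _ _ (complex.Re (`|a j| ^+ 2))%:E); last first.
  apply: esum_ge; exists [set j]; last by rewrite fsbig_set1.
  by split => //; exact: finite_set1.
rewrite lte_fin lt_def sq_ge0 andbT sqE.
rewrite paddr_eq0 ?sqr_ge0// !sqrf_eq0; move: aj0; case: (a j) => x y /=.
by rewrite eq_complex.
Qed.

HB.instance Definition _ := isDotProduct.Build R[i] ell2 ell2_dot ell2_dot_gt0.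

Let ell2_norm (a : ell2) : R[i] := sqrtC (ell2_dot a a).

Let ell2_normZ (c : R[i]) (a : ell2) : ell2_norm (c *: a) = `|c| * ell2_norm a.
Proof.
by rewrite /ell2_norm dnormZ sqrtCM ?nnegrE ?exprn_ge0// sqrCK.
Qed.

Let ell2_norm_eq0 (a : ell2) : ell2_norm a = 0 -> a = 0.
Proof. by move=> /eqP; rewrite sqrt_dnorm_eq0 => /eqP. Qed.

Let ell2_normD (a b : ell2) : ell2_norm (a + b) <= ell2_norm a + ell2_norm b.
Proof. exact: dot_triangle. Qed.

HB.instance Definition _ := Lmodule_isNormed.Build R[i] ell2
  ell2_normD ell2_normZ ell2_norm_eq0.

Lemma ell2_normE (a : ell2) : `|a| = sqrtC (ell2_dot a a).
Proof. by []. Qed.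

End ell2_def.

Record subgrp (G : zmodType) (S : zmodClosed G) := Subgrp {
  subgrp_val :> G ;
  subgrpP : subgrp_val \in S }.

Section subgrp_zmod.
Variables (G : zmodType) (S : zmodClosed G).
HB.instance Definition _ := [isSub for @subgrp_val G S].
HB.instance Definition _ := [Choice of subgrp S by <:].
HB.instance Definition _ := [SubChoice_isSubZmodule of subgrp S by <:].
End subgrp_zmod.

(* The dual of a discrete abelian group: all unitary characters, with the
   compact-open topology, i.e. that of pointwise convergence, and its Borel
   sigma-algebra. *)
Record dual (R : realType) (Gam : zmodType) := Dual {
  dual_fun :> Gam -> R[i] ;
  dualD : forall x y, dual_fun (x + y) = dual_fun x * dual_fun y ;
  dual_norm1 : forall x, `|dual_fun x| = 1 }.

Section dual_structure.
Variables (R : realType) (Gam : zmodType).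
Local Notation dual := (dual R Gam).

HB.instance Definition _ := gen_eqMixin dual.
HB.instance Definition _ := gen_choiceMixin dual.

Let dual_oneD (x y : Gam) : 1 = 1 * 1 :> R[i].
Proof. by rewrite mulr1. Qed.

Let dual_one_norm (x : Gam) : `|1| = 1 :> R[i].
Proof. exact: normr1. Qed.

Definition dual_one : dual := Dual dual_oneD dual_one_norm.

HB.instance Definition _ := isPointed.Build dual dual_one.

Let dual_mulD (chi psi : dual) x y : chi (x + y) * psi (x + y) =
  (chi x * psi x) * (chi y * psi y).
Proof. by rewrite !dualD mulrACA. Qed.

Let dual_mul_norm (chi psi : dual) x : `|chi x * psi x| = 1.
Proof. by rewrite normrM !dual_norm1 mulr1. Qed.

Definition dual_mul (chi psi : dual) : dual :=
  Dual (dual_mulD chi psi) (dual_mul_norm chi psi).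

HB.instance Definition _ := Topological.copy dual
  (initial_topology (fun chi : dual => (chi : {ptws Gam -> R[i]^o}))).

HB.instance Definition _ := @isMeasurable.Build (sigma_display (@open dual))
  dual <<s @open dual >> (@sigma_algebra0 _ setT (@open dual))
  (@sigma_algebraC _ (@open dual)) (@sigma_algebra_bigcup _ setT (@open dual)).

Variable alpha : {additive Gam -> Gam}.

Let dual_compD (chi : dual) x y :
  chi (alpha (x + y)) = chi (alpha x) * chi (alpha y).
Proof. by rewrite raddfD dualD. Qed.

Let dual_comp_norm (chi : dual) x : `|chi (alpha x)| = 1.
Proof. exact: dual_norm1. Qed.

Definition dual_endo (chi : dual) : dual :=
  Dual (dual_compD chi) (dual_comp_norm chi).

End dual_structure.

(* On the (compact metrizable) dual of a countable discrete group, regularity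
   of the Haar measure is automatic. *)
Definition normalized_haar (R : realType) (Gam : zmodType)
    (lam : probability (dual R Gam) R) : Prop :=
  forall (chi : dual R Gam) (A : set (dual R Gam)),
    measurable A -> lam (dual_mul chi @` A) = lam A.

Definition ergodic d (X : measurableType d) (R : realType)
    (P : probability X R) (f : X -> X) : Prop :=
  [/\ measurable_fun [set: X] f,
      forall A, measurable A -> P (f @^-1` A) = P A &
      forall A, measurable A -> f @^-1` A = A -> P A = 0%E \/ P A = 1%E].

Definition cosets (Gam : zmodType) (D : set Gam) : set (set Gam) :=
  range (fun x => [set x + y | y in D]).

Section hilbert.
Variables (R : realType) (E : normedModType R[i]).
Variable (dot : {dot E for conjC}).

Definition closed_subspace (V : set E) : Prop :=
  [/\ V 0, forall (a : R[i]) u v, V u -> V v -> V (a *: u + v) & closed V].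

Definition orth_proj (V : set E) (P : E -> E) : Prop :=
  forall u, V (P u) /\ forall v, V v -> dot (u - P u) v = 0.

Definition lin_indep n (u : 'I_n -> E) : Prop :=
  forall c : 'I_n -> R[i], \sum_(k < n) c k *: u k = 0 -> forall k, c k = 0.

(* The dimension in {0, 1, ..., +oo}: all infinite dimensions are +oo. *)
Definition edim (V : set E) : \bar R :=
  ereal_sup [set n%:R%:E | n in
    [set n | exists2 u : 'I_n -> E, lin_indep u & forall k, V (u k)]].

End hilbert.

Definition cmeasurable d (X : measurableType d) (R : realType)
    (f : X -> R[i]) : Prop :=
  measurable_fun [set: X] (fun x => complex.Re (f x)) /\
  measurable_fun [set: X] (fun x => complex.Im (f x)).

Definition cintegral d (X : measurableType d) (R : realType)
    (mu : {measure set X -> \bar R}) (f : X -> R[i]) : R[i] :=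
  Complex (Rintegral mu [set: X] (fun x => complex.Re (f x)))
          (Rintegral mu [set: X] (fun x => complex.Im (f x))).

(* Representations on a closed subspace K of a Hilbert space H with inner
   product dot; K is regarded as a Hilbert space in its own right, and K = setT
   for H itself. Operators on K are functions H -> H whose values outside K are
   irrelevant. *)
Section representation.
Variables (R : realType) (Gam : zmodType) (H : completeNormedModType R[i]).
Variables (dot : {dot H for conjC}) (K : set H).
Local Notation dual := (dual R Gam).

Definition unitary_on (u : H -> H) : Prop :=
  [/\ forall f, K f -> K (u f),
      forall (a : R[i]) f g, K f -> K g -> u (a *: f + g) = a *: u f + u g,
      forall f g, K f -> K g -> dot (u f) (u g) = dot f g &
      forall g, K g -> exists2 f, K f & u f = g].

Definition unitary_rep (rho : Gam -> H -> H) : Prop :=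
  (forall x, unitary_on (rho x)) /\
  forall x y f, K f -> rho (x + y) f = rho x (rho y f).

Definition projection_on (p : H -> H) : Prop :=
  [/\ forall f, K f -> K (p f),
      forall (a : R[i]) f g, K f -> K g -> p (a *: f + g) = a *: p f + p g,
      forall f, K f -> p (p f) = p f &
      forall f g, K f -> K g -> dot (p f) g = dot f (p g)].

Definition pvm (p : set dual -> H -> H) : Prop :=
  [/\ forall A, measurable A -> projection_on (p A),
      forall f, K f -> p [set: dual] f = f,
      forall A B f, measurable A -> measurable B -> K f ->
        p (A `&` B) f = p A (p B f) &
      forall (A : nat -> set dual) f, (forall n, measurable (A n)) ->
        trivIset [set: nat] A -> K f ->
        (fun n => \sum_(k < n) p (A k) f) @ \oo --> p (\bigcup_n A n) f].

(* rho x = \int (x, chi) d(p chi), in the weak sense; the quadratic form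
   suffices by polarization. *)
Definition pvm_of (rho : Gam -> H -> H) (p : set dual -> H -> H) : Prop :=
  pvm p /\
  forall f, K f -> exists2 nu : {finite_measure set dual -> \bar R},
    forall A, measurable A -> nu A = (complex.Re (dot (p A f) f))%:E &
    forall x, dot (rho x f) f = cintegral nu (fun chi => chi x).

End representation.

(* Elements of L^2 spaces are represented by functions, identified when equal
   almost everywhere. *)
Section spectral.
Variables (R : realType) (Gam : zmodType).
Local Notation dual := (dual R Gam).
Local Notation L := (ell2 R Gam).
Implicit Types (mu : {finite_measure set dual -> \bar R}) (J : dual -> set L).
Implicit Types (sigma : nat -> set dual).

Definition L2 mu (F : dual -> L) : Prop :=
  (forall a : L, cmeasurable (fun chi => ell2_dot (F chi) a)) /\
  (\int[mu]_chi (complex.Re (`|F chi| ^+ 2))%:E < +oo)%E.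

Definition range_function J : Prop := forall chi, closed_subspace (J chi).

Definition measurable_range_function J : Prop :=
  range_function J /\
  exists2 P : dual -> L -> L,
    forall chi, orth_proj (@ell2_dot R Gam) (J chi) (P chi) &
    forall a b : L, cmeasurable (fun chi => ell2_dot (P chi a) b).

(* M_J *)
Definition range_space mu J : set (dual -> L) :=
  [set F | L2 mu F /\ {ae mu, forall chi, J chi (F chi)}].

(* The direct sum of the L^2(sigma_i, mu), as a subspace of
   L^2(dual, l^2(Gam), mu) through the enumeration enum of Gam; the index i
   starts at 0. *)
Definition direct_sum (enum : nat -> Gam) mu sigma : set (dual -> L) :=
  [set F | L2 mu F /\
    forall i, {ae mu, forall chi, ~ sigma i chi -> F chi (enum i) = 0}].

Definition multiplicity sigma (chi : dual) : \bar R :=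
  (\sum_(0 <= i <oo) (\1_(sigma i) chi)%:E)%E.

Variables (H : completeNormedModType R[i]) (dot : {dot H for conjC}).

Record unitary_onto (K : set H) mu (M : set (dual -> L)) (T : H -> dual -> L) :
    Prop := UnitaryOnto {
  uo_mem : forall f, K f -> M (T f) ;
  uo_linear : forall (a : R[i]) f g, K f -> K g ->
    {ae mu, forall chi, T (a *: f + g) chi = a *: T f chi + T g chi} ;
  uo_norm : forall f, K f ->
    (\int[mu]_chi (complex.Re (`|T f chi| ^+ 2))%:E =
     (complex.Re (`|f| ^+ 2))%:E)%E ;
  uo_onto : forall F, M F ->
    exists2 f, K f & {ae mu, forall chi, F chi = T f chi} }.

(* sd_support is what makes mu unique up to equivalence; sd_restr is the
   normalization of mu in its equivalence class when mu `<< lam. *)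
Record spectral_data (lam : probability dual R) (enum : nat -> Gam)
    (K : set H) (rho : Gam -> H -> H)
    mu sigma (T : H -> dual -> L) : Prop := SpectralData {
  sd_measurable : forall i, measurable (sigma i) ;
  sd_nested : forall i, sigma i.+1 `<=` sigma i ;
  sd_support : mu (~` sigma 0%N) = 0%E ;
  sd_restr : mu `<< lam ->
    forall A, measurable A -> mu A = lam (A `&` sigma 0%N) ;
  sd_unitary : unitary_onto K mu (direct_sum enum mu sigma) T ;
  sd_intertwine : forall i x f, K f -> {ae mu, forall chi : dual,
    T (rho x f) chi (enum i) = chi x * T f chi (enum i)} ;
  sd_pvm : exists2 p, pvm_of dot K rho p &
    forall A f, measurable A -> K f -> {ae mu, forall chi,
      T (p A f) chi = \1_A chi *: T f chi} }.

(* J is the range function associated with V through T, i.e. T(V) = M_J. *)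
Definition range_function_of mu (T : H -> dual -> L) (V : set H) J : Prop :=
  measurable_range_function J /\
  forall F, range_space mu J F <->
    L2 mu F /\ exists2 f, V f & {ae mu, forall chi, F chi = T f chi}.

End spectral.

(* Main.v *)
(* For f in V the scalar spectral measure of f is both |T f|^2 mu and |T' f|^2 mu',
   because both have Fourier coefficients (pi x f, f) and a finite measure on the
   compact group dual to Gam is determined by its Fourier coefficients. Hence mu'
   is absolutely continuous with respect to mu. If f_0, ..., f_n in V are mapped by
   T' to the constant basis vectors e_0, ..., e_n over sigma'_n, then polarization
   shows that at almost every point of sigma'_n the vectors T f_0, ..., T f_n of J
   are orthogonal of equal nonzero norm, so dim J >= n + 1 there. On the other hand
   T'(V) is the whole direct sum, so J' is a.e. the closed span of the e_i with
   chi in sigma'_i, and its dimension is the multiplicity. *)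

Require Import Defs.
From HB Require Import structures.
From mathcomp Require Import all_boot all_order all_algebra.
From mathcomp Require Import complex ring lra.
From mathcomp Require Import all_classical all_reals all_analysis.
From mathcomp Require Import measurable_realfun.

Set Implicit Arguments.
Unset Strict Implicit.
Unset Printing Implicit Defensive.

Import Order.TTheory GRing.Theory Num.Theory Num.Def.
Import numFieldNormedType.Exports.

Local Open Scope classical_set_scope.
Local Open Scope ring_scope.

(** * Real parts and moduli of complex numbers *)

Section complex_facts.
Variable R : realType.
Implicit Types z w : R[i].

Lemma ReD z w : complex.Re (z + w) = complex.Re z + complex.Re w.
Proof. by case: z => a b; case: w. Qed.

Lemma Im_Re z : complex.Im z = complex.Re (- 'i%C * z).
Proof. by case: z => a b /=; ring. Qed.

Lemma Re_normsqr z :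
  complex.Re (`|z| ^+ 2) = complex.Re z ^+ 2 + complex.Im z ^+ 2.
Proof. by rewrite -add_Re2_Im2. Qed.

Lemma Re_normsqr_ge0 z : 0 <= complex.Re (`|z| ^+ 2).
Proof. by rewrite Re_normsqr addr_ge0// sqr_ge0. Qed.

Lemma normRe_le z : `|complex.Re z| <= complex.Re `|z|.
Proof.
by rewrite normc_def /= -sqrtr_sqr ler_sqrt ?addr_ge0 ?sqr_ge0// lerDl sqr_ge0.
Qed.

Lemma normcRE z : `|z| = (complex.Re `|z|)%:C%C.
Proof. by rewrite normc_def. Qed.

End complex_facts.

(** * Polynomial approximation of the sign *)

Section sign_polynomials.
Variable R : realType.
Implicit Types u : R.

(* On [-1, 1] the iterates of this polynomial converge pointwise to the sign
   function: its fixed points are -1, 0, 1, and 0 is repelling. *)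
Definition sgn_step u : R := (3 * u - u ^+ 3) / 2.

Lemma sgn_stepN u : sgn_step (- u) = - sgn_step u.
Proof. by rewrite /sgn_step; field. Qed.

Lemma sgn_step0 : sgn_step 0 = 0.
Proof. by rewrite /sgn_step mulr0 expr0n subrr mul0r. Qed.

Lemma iter_sgn_step0 n : iter n sgn_step 0 = 0.
Proof. by elim: n => // n IH; rewrite iterS IH sgn_step0. Qed.

Lemma iter_sgn_stepN n u : iter n sgn_step (- u) = - iter n sgn_step u.
Proof. by elim: n => // n IH; rewrite !iterS IH sgn_stepN. Qed.

(** On ]0, 1] a step from v multiplies the distance to 1 by at most 1 - v / 2. The iterates
    increase, so v >= u and each of these factors is at most 1 - u / 2. *)
Lemma iter_sgn_step_bound n u : 0 < u <= 1 ->
  u <= iter n sgn_step u <= 1 /\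
  1 - iter n sgn_step u <= (1 - u / 2) ^+ n.
Proof.
move=> /andP[u0 u1]; elim: n => [|n [/andP[un n1] ih]].
  by rewrite /= lexx u1 expr0 lerBlDr lerDl ltW.
rewrite iterS exprS; set v := iter n sgn_step u in un n1 ih *.
have v0 : 0 < v by exact: lt_le_trans un.
have E1 : sgn_step v - v = v * (1 - v) * (1 + v) / 2.
  by rewrite /sgn_step; field.
have E2 : 1 - sgn_step v = (1 - v) * (1 - v / 2 - v ^+ 2 / 2).
  by rewrite /sgn_step; field.
have vv : v <= sgn_step v.
  rewrite -subr_ge0 E1 divr_ge0// !mulr_ge0//; lra.
split; first rewrite (le_trans un vv)/=.
  rewrite -subr_ge0 E2 mulr_ge0//; first lra.
  have : v ^+ 2 <= 1 by rewrite expr_le1// ltW.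
  lra.
rewrite E2 mulrC ler_pM//.
- have : v ^+ 2 <= 1 by rewrite expr_le1// ltW.
  lra.
- lra.
- by have := sqr_ge0 v; lra.
Qed.

Lemma iter_sgn_step_le1 n u : `|u| <= 1 -> `|iter n sgn_step u| <= 1.
Proof.
have pos v : 0 < v -> v <= 1 -> `|iter n sgn_step v| <= 1.
  move=> v0 v1; have [|/andP[a b] _] := @iter_sgn_step_bound n v.
    by rewrite v0.
  by rewrite ger0_norm// (le_trans _ a)// ltW.
rewrite ler_norml => /andP[u1 u2]; have [u0|u0|u0] := ltrgt0P u.
- exact: pos.
- by rewrite -[u]opprK iter_sgn_stepN normrN pos ?oppr_gt0//; lra.
- rewrite u0; suff -> : iter n sgn_step 0 = 0 by rewrite normr0.
  exact: iter_sgn_step0.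
Qed.

Lemma iter_sgn_step_cvg u : `|u| <= 1 ->
  iter n sgn_step u @[n --> \oo] --> (Num.sg u : R).
Proof.
have pos (v : R) : 0 < v -> v <= 1 -> iter n sgn_step v @[n --> \oo] --> (1 : R).
  move=> v0 v1.
  apply: (@squeeze_cvgr _ _ _ _ (fun n => 1 - (1 - v / 2) ^+ n) (cst 1)).
  - apply: nearW => n; have [|/andP[_ b] c] := @iter_sgn_step_bound n v.
      by rewrite v0.
    by rewrite b andbT lerBlDr -lerBlDl.
  - rewrite -[X in _ --> X]subr0; apply: cvgB; first exact: cvg_cst.
    by apply: cvg_expr; rewrite ger0_norm; lra.
  - exact: cvg_cst.
rewrite ler_norml => /andP[u1 u2]; have [u0|u0|u0] := ltrgt0P u.
- by rewrite gtr0_sg//; exact: pos.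
- rewrite ltr0_sg//; rewrite -[u]opprK.
  under eq_fun do rewrite iter_sgn_stepN.
  by apply: cvgN; apply: pos; lra.
- rewrite u0 sgr0 (_ : (fun _ => _) = cst 0); first exact: cvg_cst.
  by apply/funext => n; exact: iter_sgn_step0.
Qed.

(* (sg + sg ^ 2) / 2 is the indicator of ]0, +oo[. *)
Definition pos_poly n u : R :=
  2^-1 * iter n sgn_step u + 2^-1 * (iter n sgn_step u * iter n sgn_step u).

Lemma pos_poly_le1 n u : `|u| <= 1 -> `|pos_poly n u| <= 1.
Proof.
move=> /(iter_sgn_step_le1 n); rewrite /pos_poly; set v := iter _ _ _ => v1.
rewrite (le_trans (ler_normD _ _))// !normrM ger0_norm ?invr_ge0//.
have : `|v| * `|v| <= 1 by rewrite mulr_ile1.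
lra.
Qed.

Lemma pos_poly_cvg u : `|u| <= 1 ->
  pos_poly n u @[n --> \oo] --> ((0 < u)%R%:R : R).
Proof.
move=> u1; have s := @iter_sgn_step_cvg u u1.
have -> : (0 < u)%R%:R = 2^-1 * Num.sg u + 2^-1 * (Num.sg u * Num.sg u) :> R.
  case: sgrP => _ /=; lra.
by apply: cvgD; apply: cvgM => //; [exact: cvg_cst|exact: cvg_cst|exact: cvgM].
Qed.

End sign_polynomials.

(** * Uniqueness of Fourier coefficients on the dual group *)

Section characters.
Variables (R : realType) (Gam : zmodType).
Local Notation dual := (dual R Gam).
Implicit Types (chi : dual) (x y : Gam) (a b : R[i]).

Lemma dual0 chi : chi 0 = 1.
Proof.
have chi0 : chi 0 != 0 by rewrite -normr_gt0 dual_norm1.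
by apply: (mulfI chi0); rewrite mulr1 -dualD addr0.
Qed.

Lemma dualN chi x : chi (- x) = (chi x)^*.
Proof.
have chix : chi x != 0 by rewrite -normr_gt0 dual_norm1.
by apply: (mulfI chix); rewrite -dualD subrr dual0 -normCK dual_norm1 expr1n.
Qed.

(* Taking real parts of a * chi x for all complex a covers both the real and the
   imaginary parts of characters. *)
Inductive trig : (dual -> R) -> Prop :=
| trig_base a x : trig (fun chi => complex.Re (a * chi x))
| trig_add f g : trig f -> trig g -> trig (fun chi => f chi + g chi).

Lemma trig_cst (c : R) : trig (fun=> c).
Proof.
have := trig_base c%:C%C 0; congr trig; apply/funext => chi.
by rewrite dual0 mulr1.
Qed.

Lemma trig_mul (f g : dual -> R) :
  trig f -> trig g -> trig (fun chi => f chi * g chi).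
Proof.
move=> tf; elim: tf g => [a x|{}f h _ IHf _ IHh] g tg; last first.
  under eq_fun do rewrite mulrDl.
  by apply: trig_add; [exact: IHf|exact: IHh].
elim: tg => [b y|{}g h _ IHg _ IHh]; last first.
  under eq_fun do rewrite mulrDr.
  exact: trig_add.
(* Re z times Re w is half the sum of Re (z w) and of the real part of z times the conjugate of w;
   conjugating [chi y] gives [chi (- y)]. *)
have := trig_add (trig_base (2^-1 * (a * b)) (x + y))
                 (trig_base (2^-1 * (a * b^*)) (x - y)).
congr trig; apply/funext => chi; rewrite !dualD dualN.
have -> : (2^-1 : R[i]) = (2^-1)%:C%C by rewrite fmorphV/= rmorph_nat.
case: a b (chi x) (chi y) => [a1 a2] [b1 b2] [x1 x2] [y1 y2] /=.
by field.
Qed.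

Lemma trig_iter_sgn_step n (f : dual -> R) :
  trig f -> trig (fun chi => iter n (@sgn_step R) (f chi)).
Proof.
move=> tf; elim: n => // n IH; rewrite /= /sgn_step.
have := trig_add (trig_mul (trig_cst (3 / 2)) IH)
  (trig_mul (trig_cst (- 2^-1)) (trig_mul IH (trig_mul IH IH))).
by congr trig; apply/funext => chi; field.
Qed.

Lemma trig_pos_poly n (f : dual -> R) :
  trig f -> trig (fun chi => pos_poly n (f chi)).
Proof.
move=> /(trig_iter_sgn_step n) tf; apply: trig_add.
  exact: trig_mul (trig_cst _) tf.
exact: trig_mul (trig_cst _) (trig_mul tf tf).
Qed.

Lemma norm_trig_base_le a x chi :
  `|complex.Re (a * chi x)| <= complex.Re `|a|.
Proof. by rewrite (le_trans (normRe_le _))// normrM dual_norm1 mulr1. Qed.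

Lemma trig_bounded (f : dual -> R) :
  trig f -> exists M, forall chi, `|f chi| <= M.
Proof.
elim=> [a x|{}f g _ [M fM] _ [N gN]].
  by exists (complex.Re `|a|) => chi; exact: norm_trig_base_le.
by exists (M + N) => chi; rewrite (le_trans (ler_normD _ _))// lerD.
Qed.

Lemma dual_eval_continuous x : continuous (fun chi : dual => (chi x : R[i]^o)).
Proof.
move=> chi.
have c1 : continuous (fun chi : dual => (chi : {ptws Gam -> R[i]^o})).
  exact: initial_continuous.
apply: (@continuous_comp _ _ _ (fun chi : dual => (chi : {ptws Gam -> R[i]^o}))
  (fun f : {ptws Gam -> R[i]^o} => f x)); first exact: c1.
exact: (@proj_continuous Gam (fun=> R[i]^o) x).
Qed.

Lemma open_half_plane a (t : R) : open [set z : R[i]^o | t < complex.Re (a * z)].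
Proof.
rewrite openE => z /= tz; apply/nbhs_ballP.
pose d := complex.Re (a * z) - t.
have d0 : 0 < d by rewrite subr_gt0.
(* The summand 1 keeps the radius below well defined when a = 0. *)
have a0 : 0 < complex.Re `|a| + 1.
  by rewrite ltr_wpDl// normc_def /= sqrtr_ge0.
exists (d / (complex.Re `|a| + 1))%:C%C => /=.
  by rewrite ltcR divr_gt0.
move=> w; rewrite /ball /= => zw.
have : complex.Re (a * (z - w)) < d.
  apply: (le_lt_trans (ler_norm _)); apply: (le_lt_trans (normRe_le _)).
  move: zw; rewrite normrM (normcRE a) (normcRE (z - w)) -rmorphM ltcR /=.
  rewrite ltr_pdivlMr// mulrC; apply: le_lt_trans.
  rewrite ler_wpM2r ?lerDl//.
  by case: (z - w) => p q; exact: sqrtr_ge0.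
by rewrite mulrBr ReD raddfN /= /d; lra.
Qed.
End characters.

(** * Borel sets of the dual, and measures determined by trigonometric integrals *)

Section borel.
Variables (R : realType) (Gam : zmodType).
Local Notation dual := (dual R Gam).
Implicit Types (chi : dual) (x : Gam) (a : R[i]).

Definition half_space (p : R[i] * Gam * R) : set dual :=
  [set chi | p.2 < complex.Re (p.1.1 * chi p.1.2)].

(** Indexing by finite sequences turns intersection into concatenation, and makes the family
    countable once the entries come from a countable type. *)
Definition box (s : seq (R[i] * Gam * R)) : set dual :=
  foldr (fun p A => half_space p `&` A) setT s.

Lemma box_cat s t : box (s ++ t) = box s `&` box t.
Proof. by elim: s => [|p s IH] /=; rewrite ?setTI// IH setIA. Qed.

Lemma boxP s chi : box s chi <-> forall p, p \in s -> half_space p chi.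
Proof.
elim: s => [|p s IH]; first by split.
rewrite /= in IH *; split => [[hp /IH hs] q|h].
  by rewrite inE => /orP[/eqP ->//|]; exact: hs.
split; first by apply: h; rewrite mem_head.
by apply/IH => q qs; apply: h; rewrite inE qs orbT.
Qed.

Lemma open_half_space p : open (half_space p).
Proof.
have /continuousP := @dual_eval_continuous R Gam p.1.2.
by move=> /(_ _ (@open_half_plane R p.1.1 p.2)).
Qed.

Lemma measurable_half_space p : measurable (half_space p).
Proof. by apply: sub_sigma_algebra; exact: open_half_space. Qed.

Lemma measurable_box s : measurable (box s).
Proof.
elim: s => [|p s IH] /=; first exact: measurableT.
by apply: measurableI => //; exact: measurable_half_space.
Qed.

Lemma measurable_trig (f : dual -> R) : trig f -> measurable_fun [set: dual] f.
Proof.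
elim=> [a x|{}f g _ mf _ mg]; last exact: measurable_funD.
apply: (measurability _ (RGenOInfty.measurableE R)) => _ [_ [t ->] <-].
rewrite setTI; have := measurable_half_space (a, x, t).
congr measurable; apply/seteqP; split => chi /=;
  by rewrite /half_space /= in_itv/= andbT.
Qed.

Variable enum : nat -> Gam.
Hypothesis enum_surj : forall x, exists n, enum n = x.

(** If every k failed, choosing a bad character for each k would give a sequence outside A that
    converges to chi at every [enum i], hence pointwise, hence in the dual. The single k serves both
    as the number of coordinates controlled and as the inverse of the tolerance. *)
Lemma dual_cvg_nbhs chi (A : set dual) : nbhs chi A ->
  exists2 k : nat, (0 < k)%N & forall psi : dual,
    (forall i, (i < k)%N ->
      `|chi (enum i) - psi (enum i)| < (k%:R^-1)%:C%C) -> A psi.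
Proof.
move=> nA; apply: contrapT => noA.
have /choice[psi psiP] : forall k : nat, exists psi : dual, ~ A psi /\
    forall i, (i < k.+1)%N ->
      `|chi (enum i) - psi (enum i)| < (k.+1%:R^-1)%:C%C.
  move=> k; apply: contrapT => /forallNP nopsi; apply: noA; exists k.+1 => //.
  move=> psi psik; apply: contrapT => nApsi; exact: (nopsi psi).
suff : psi @ \oo --> chi.
  move=> /(_ A nA) [N _ /(_ N (leqnn N))] /=; exact: (psiP N).1.
have pw0 x : (fun n => psi n x : R[i]^o) @ \oo --> (chi x : R[i]^o).
  have [n0 <-] := enum_surj x.
  apply/cvg_ballP => e e0.
  have e0' : 0 < complex.Re e by move: e0; rewrite ltcE => /andP[].
  near=> n; rewrite /ball /=.
  have n0n : (n0 < n.+1)%N by rewrite ltnS; near: n; exists n0.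
  apply: (lt_trans ((psiP n).2 n0 n0n)).
  have -> : e = (complex.Re e)%:C%C.
    by rewrite RRe_real// gtr0_real.
  rewrite ltcR.
  near: n; exact: near_infty_natSinv_lt (PosNum e0').
have pw : (fun n => (psi n : {ptws Gam -> R[i]^o})) @ \oo -->
    (chi : {ptws Gam -> R[i]^o}).
  have surj x : (fun f : Gam -> R[i]^o => f x) @` setT = setT.
    by apply/seteqP; split => // z _; exists (fun=> z).
  (* The product topology is the supremum of the topologies induced by the evaluations; these are
     surjective, so convergence reduces to [pw0]. *)
  apply/cvg_sup => x; apply/cvg_image; first exact: surj.
  apply: cvg_trans (pw0 x) => W /= ?; exists ((fun f => f x) @^-1` W) => //.
  exact: image_preimage.
move=> B /=; rewrite nbhsE => -[C [[D oD DC] Cchi] CB].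
have : nbhs (chi : {ptws Gam -> R[i]^o}) D.
  by apply: open_nbhs_nbhs; split => //; move: Cchi; rewrite -DC.
move=> /pw; rewrite !nbhs_simpl/=; apply: filterS => n Dn; apply: CB.
by rewrite -DC.
Unshelve. all: by end_near. Qed.

(* Half-spaces bounding z, i z, - z and - i z from below cut out squares. *)
Let decode (c : nat * nat * rat) : R[i] * Gam * R :=
  ('i%C ^+ c.1.1, enum c.1.2, ratr c.2).

Lemma nbhs_box (chi : dual) (A : set dual) : nbhs chi A ->
  exists2 s, box (map decode s) chi & box (map decode s) `<=` A.
Proof.
move=> /dual_cvg_nbhs[k k0 kA].
(* If the real and imaginary parts both differ by less than e, the modulus of the difference is
   below sqrt 2 times e, hence below 2 e = 1 / k. *)
pose e : R := k%:R^-1 / 2.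
have e0 : 0 < e by rewrite divr_gt0// invr_gt0 ltr0n.
(* The thresholds lie strictly below the values at chi, so that chi is in the box, and within e of
   them; taking them rational keeps the codes countable. *)
have /choice[q qP] : forall p : nat * nat, exists q : rat,
    ratr q \in `]complex.Re ('i%C ^+ p.1 * chi (enum p.2)) - e,
                 complex.Re ('i%C ^+ p.1 * chi (enum p.2))[.
  by move=> p; apply: rat_in_itvoo; rewrite ltrBlDr ltrDl.
exists [seq (p, q p) | p <- [seq (j, i) | j <- iota 0 4, i <- iota 0 k]].
  apply/boxP => _ /mapP[_ /mapP[p _ ->] ->].
  by have := qP p; rewrite /half_space in_itv /= => /andP[].
move=> psi /boxP psiB; apply: kA => i ik.
have H j : (j < 4)%N -> complex.Re ('i%C ^+ j * chi (enum i)) - e <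
    complex.Re ('i%C ^+ j * psi (enum i)).
  move=> j4; have /psiB : decode (j, i, q (j, i)) \in map decode
      [seq (p, q p) | p <- [seq (j, i) | j <- iota 0 4, i <- iota 0 k]].
    apply/map_f/(map_f (fun p => (p, q p))).
    by apply/allpairsP; exists (j, i); split => //; rewrite mem_iota.
  apply: lt_trans.
  by have := qP (j, i); rewrite in_itv /= => /andP[].
have := (H 0 isT); have := (H 1 isT); have := (H 2 isT); have := (H 3 isT).
rewrite !exprS expr0 mulr1; case: (chi _) (psi _) => [x1 y1] [x2 y2] /=.
rewrite !(mul0r, mul1r, mulr0, mulr1, oppr0, add0r, addr0, subr0, sub0r, mulN1r).
rewrite !opprK => y2l x2g y2g x2l.
have ek : k%:R^-1 = e + e by rewrite /e; field; rewrite pnatr_eq0 -lt0n.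
rewrite normc_def ltcR ek -[ltRHS]ger0_norm; last by rewrite addr_ge0// ltW.
rewrite -sqrtr_sqr ltr_sqrt /=; last by rewrite exprn_gt0// addr_gt0.
have sq (v : R) : - e < v -> v < e -> v ^+ 2 < e ^+ 2.
  by move=> v1 v2; rewrite -subr_gt0 subr_sqr mulr_gt0//; lra.
have := sqr_ge0 e; have : (x1 - x2) ^+ 2 < e ^+ 2 by apply: sq; lra.
have : (y1 - y2) ^+ 2 < e ^+ 2 by apply: sq; lra.
rewrite sqrrD; lra.
Qed.

(** The coded boxes are countably many and give every point arbitrarily small neighbourhoods, so an
    open set is the countable union of those it contains. *)
Lemma dual_measurableE : @measurable _ dual = <<s range box >>.
Proof.
apply/seteqP; split; last first.
  apply: smallest_sub; first exact: sigma_algebra_measurable.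
  by move=> _ [s _ <-]; exact: measurable_box.
apply: smallest_sub; first exact: smallest_sigma_algebra.
move=> U oU.
pose B n := if unpickle n is Some s then
  if `[< box (map decode s) `<=` U >] then box (map decode s) else set0 else set0.
have -> : U = \bigcup_n B n.
  apply/seteqP; split => [chi Uchi|chi [n _]].
    have [|s schi sU] := @nbhs_box chi U.
      by apply: open_nbhs_nbhs.
    by exists (pickle s) => //; rewrite /B pickleK asboolT.
  rewrite /B; case: (unpickle n) => // s.
  by case: asboolP => // + ?; exact.
apply: sigma_algebra_bigcup => n; rewrite /B.
case: (unpickle n) => [s|]; last exact: sigma_algebra0.
by case: asboolP => _; [apply: sub_sigma_algebra; exists (map decode s)
                       |exact: sigma_algebra0].
Qed.

(** The domain A is a parameter so that agreement can be carried from the whole dual to boxes, one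
    half-space at a time. *)
Definition trig_agree (nu1 nu2 : {finite_measure set dual -> \bar R}) A :=
  forall f, trig f ->
    \int[nu1]_(chi in A) f chi = \int[nu2]_(chi in A) f chi.

Lemma finite_measure_bounded_integrable
    (nu : {finite_measure set dual -> \bar R}) A (f : dual -> R) M :
  measurable A -> measurable_fun A f -> (forall chi, `|f chi| <= M) ->
  nu.-integrable A (EFin \o f).
Proof.
move=> mA mf fM; apply: measurable_bounded_integrable => //.
  by rewrite -ge0_fin_numE//; exact: fin_num_measure.
exists M; split => [|N MN chi _ /=]; first exact: num_real.
by rewrite (le_trans (fM chi))// ltW.
Qed.

Lemma trig_integrable (nu : {finite_measure set dual -> \bar R}) A f :
  measurable A -> trig f -> nu.-integrable A (EFin \o f).
Proof.
move=> mA tf; have [M fM] := trig_bounded tf.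
apply: (@finite_measure_bounded_integrable nu A f M) => //.
by apply: measurable_funS (measurable_trig tf).
Qed.

(** The indicator of the half-space is a bounded pointwise limit of polynomials in a trigonometric
    function. Multiplying f by these polynomials stays within [trig], so the integrals over A agree
    at each stage, and dominated convergence passes the equality to the limit. *)
Lemma trig_agreeI nu1 nu2 A p : measurable A ->
  trig_agree nu1 nu2 A -> trig_agree nu1 nu2 (half_space p `&` A).
Proof.
move=> mA agA f tf; case: p => [[a x] t].
(* K bounds the modulus of Re (a * chi x) - t, so u takes values in [-1, 1], where [pos_poly]
   converges; the 1 makes K positive. *)
pose K := 1 + complex.Re `|a| + `|t|.
have Re0 : 0 <= complex.Re `|a| by rewrite normc_def /= sqrtr_ge0.
have K0 : 0 < K by rewrite /K -addrA ltr_pwDl// addr_ge0.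
pose u (chi : dual) : R := K^-1 * complex.Re (a * chi x) + K^-1 * - t.
have uE chi : u chi = (complex.Re (a * chi x) - t) / K.
  by rewrite /u -mulrDr mulrC.
have tu : trig u.
  apply: trig_add; last exact: trig_cst.
  exact: (trig_mul (trig_cst _ _) (trig_base _ _)).
have u1 chi : `|u chi| <= 1.
  rewrite uE normrM [X in _ * X]gtr0_norm ?invr_gt0// ler_pdivrMr// mul1r.
  rewrite (le_trans (ler_normB _ _))// lerD2r.
  by rewrite (le_trans (norm_trig_base_le _ _ _))// lerDr.
pose h n (chi : dual) := f chi * pos_poly n (u chi).
have th n : trig (h n) by apply: trig_mul => //; exact: trig_pos_poly.
pose g := f \_ (half_space (a, x, t)).
have hg chi : h n chi @[n --> \oo] --> g chi.
  have -> : g chi = f chi * (0 < u chi)%R%:R.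
    rewrite /g patchE uE pmulr_lgt0 ?invr_gt0// subr_gt0.
    case: ifPn => [/set_mem /= ->|]; first by rewrite mulr1.
    by rewrite notin_setE /half_space/= => /negP/negbTE ->; rewrite mulr0.
  by apply: cvgM; [exact: cvg_cst|exact: pos_poly_cvg].
have [M fM] := trig_bounded tf.
have hM n chi : `|h n chi| <= M.
  rewrite /h normrM (le_trans _ (fM chi))// ler_piMr//.
  exact: pos_poly_le1.
have mg : measurable_fun A g.
  apply: (measurable_fun_cvg (h := h)) => // n.
  by apply: measurable_funS (measurable_trig (th n)).
have lim (nu : {finite_measure set dual -> \bar R}) :
    (\int[nu]_(chi in A) h n chi)%R @[n --> \oo] -->
    (\int[nu]_(chi in half_space (a, x, t) `&` A) f chi)%R.
  rewrite Rintegral_mkcondl -/g; apply: fine_cvg.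
  have iM : nu.-integrable A (EFin \o cst M).
    apply: (@finite_measure_bounded_integrable nu A _ `|M|) => //.
  have ig : nu.-integrable A (EFin \o g).
    apply: (@finite_measure_bounded_integrable nu A _ `|M|) => // chi.
    rewrite /g patchE; case: ifPn => _; last by rewrite normr0.
    by rewrite (le_trans (fM chi))// ler_norm.
  rewrite fineK; last exact: integrable_fin_num.
  have mh n : measurable_fun A (EFin \o h n).
    by apply/measurable_EFinP; apply: measurable_funS (measurable_trig (th n)).
  have mg' : measurable_fun A (EFin \o g) by exact/measurable_EFinP.
  have cv : {ae nu, forall chi, A chi ->
      (EFin \o h n) chi @[n --> \oo] --> (EFin \o g) chi}.
    by apply: aeW => chi _; apply: cvg_EFin; [exact: nearW|exact: hg].
  have dom : {ae nu, forall chi n, A chi ->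
      (`|(EFin \o h n) chi| <= (EFin \o cst M) chi)%E}.
    by apply: aeW => chi n _; rewrite /= lee_fin.
  by have [_ _] := dominated_convergence mA mh mg' cv iM dom.
have e : (fun n => \int[nu1]_(chi in A) h n chi)%R =
    (fun n => \int[nu2]_(chi in A) h n chi)%R.
  by apply/funext => n; exact: agA.
by have := lim nu1; rewrite e => l1; exact: (cvg_unique _ l1 (lim nu2)).
Qed.

Lemma trig_agree_box nu1 nu2 s :
  trig_agree nu1 nu2 setT -> trig_agree nu1 nu2 (box s).
Proof.
move=> ag; elim: s => //= p s IH.
by apply: trig_agreeI => //; exact: measurable_box.
Qed.

(** Equal coefficients give equal integrals of all [trig] functions over the dual, hence over every
    box. The constant 1 then shows that the measures agree on boxes, which are stable under
    intersection, include the whole space and generate the Borel sets. *)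
Lemma fourier_unique (nu1 nu2 : {finite_measure set dual -> \bar R}) :
  (forall x, cintegral nu1 (fun chi => chi x) =
             cintegral nu2 (fun chi => chi x)) ->
  forall A, measurable A -> nu1 A = nu2 A.
Proof.
move=> nu12.
have ag : trig_agree nu1 nu2 setT.
  move=> f; elim=> [a x|{}f g tf IHf tg IHg]; last first.
    have itf nu := trig_integrable nu measurableT tf.
    have itg nu := trig_integrable nu measurableT tg.
    rewrite !RintegralD// ?IHf ?IHg//; [exact: itf|exact: itg|exact: itf|exact: itg].
  have E (nu : {finite_measure set dual -> \bar R}) :
      \int[nu]_chi complex.Re (a * chi x) =
      complex.Re (a * cintegral nu (fun chi => chi x)).
    case: a => a1 a2; rewrite /cintegral /=.
    have i1 : nu.-integrable setT (EFin \o (fun chi : dual => complex.Re (chi x))).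
      have := trig_integrable nu measurableT (trig_base 1 x).
      by congr (_.-integrable _ (_ \o _)); apply/funext => chi; rewrite mul1r.
    have i2 : nu.-integrable setT (EFin \o (fun chi : dual => complex.Im (chi x))).
      have := trig_integrable nu measurableT (trig_base (- 'i%C) x).
      by congr (_.-integrable _ (_ \o _)); apply/funext => chi; rewrite Im_Re.
    rewrite -!RintegralZl// -RintegralB//.
    - by apply: eq_Rintegral => chi _; case: (chi x).
    - by have := integrableZl measurableT a1 i1.
    - by have := integrableZl measurableT a2 i2.
  by rewrite !E nu12.
apply: (measure_unique (range box) (fun=> setT)).
- exact: dual_measurableE.
- by move=> _ _ [s _ <-] [t _ <-]; exists (s ++ t); rewrite ?box_cat.
- by move=> _; exists [::].
- by rewrite bigcup_const.
- move=> _ [s _ <-].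
  have := trig_agree_box s ag (trig_cst _ 1).
  rewrite !Rintegral_cst ?mul1r; [|exact: measurable_box..] => h.
  rewrite -[LHS]fineK ?h ?fineK//; apply: fin_num_measure; exact: measurable_box.
- by move=> _; rewrite -ge0_fin_numE//; exact: fin_num_measure.
Qed.

End borel.

(** * Square summable families *)

Section dot_facts.
Variables (R : realType) (U : lmodType R[i]) (dot : {dot U for conjC}).

Lemma dnormZD (c : R[i]) (u v : U) :
  dot (c *: u + v) (c *: u + v) =
  `|c| ^+ 2 * dot u u + dot v v + (c * dot u v + (c * dot u v)^*).
Proof. by rewrite dnormD dnormZ linearZl_LR. Qed.

Lemma dot_sum_orth n (c : 'I_n -> R[i]) (u : 'I_n -> U) j :
  (forall k, k != j -> dot (u k) (u j) = 0) ->
  dot (\sum_k c k *: u k) (u j) = c j * dot (u j) (u j).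
Proof.
move=> uj; rewrite linear_sumlz /= (bigD1 j)//= big1 ?addr0 ?linearZl_LR//.
by move=> k kj; rewrite linearZl_LR /= uj// mulr0.
Qed.

End dot_facts.

Section ell2_facts.
Variables (R : realType) (I : choiceType).
Local Notation L := (ell2 R I).
Implicit Types (a b u v : L) (c : R[i]).

(** The norm of [ell2] takes values in [R[i]]; the real part yields the real integrand that occurs
    in [L2] and [uo_norm]. *)
Definition sqn a : R := complex.Re (`|a| ^+ 2).

Lemma ell2_dotE a : ell2_dot a a = (sqn a)%:C%C.
Proof.
by rewrite /sqn ell2_normE sqrtCK RRe_real// ger0_real// dnorm_ge0.
Qed.

Lemma ell2_dotC a b : ell2_dot a b = (ell2_dot b a)^*.
Proof. by rewrite (hermC (@ell2_dot R I)) expr0 mul1r. Qed.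

Lemma sqn_ge0 a : 0 <= sqn a.
Proof. by rewrite -ler0c -ell2_dotE dnorm_ge0. Qed.

Lemma sqn_eq0 a : (sqn a == 0) = (a == 0).
Proof.
have <- : (ell2_dot a a == 0) = (a == 0) := dnorm_eq0 (@ell2_dot R I) a.
by rewrite ell2_dotE eq_complex /= eqxx andbT.
Qed.

Lemma sqnZD c u v :
  sqn (c *: u + v) = complex.Re (`|c| ^+ 2) * sqn u + sqn v +
    2 * complex.Re (c * ell2_dot u v).
Proof.
rewrite -[LHS]/(complex.Re (sqn _)%:C%C) -ell2_dotE.
have -> : ell2_dot (c *: u + v) (c *: u + v) = `|c| ^+ 2 * ell2_dot u u +
    ell2_dot v v + (c * ell2_dot u v + (c * ell2_dot u v)^*).
  exact: (dnormZD (@ell2_dot R I) c u v).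
rewrite !ell2_dotE.
rewrite Re_normsqr -add_Re2_Im2; case: (c * ell2_dot u v) => x y /=; ring.
Qed.

(** Polarization: the sum u + v kills the real part of the inner product, and i u + v kills its
    imaginary part. Only square norms enter, and these are what can be compared between the two
    spectral measures. *)
Lemma ell2_orth u v w : sqn u = w -> sqn v = w ->
  sqn (u + v) = 2 * w -> sqn ('i%C *: u + v) = 2 * w -> ell2_dot u v = 0.
Proof.
move=> uw vw; rewrite -[u in sqn (u + v)]scale1r !sqnZD !Re_normsqr uw vw.
case: (ell2_dot u v) => x y /=; rewrite !expr0n !expr1n /= => h1 h2.
apply/eqP; rewrite eq_complex /=.
by apply/andP; split; apply/eqP; lra.
Qed.

Lemma lin_indep_orth n (u : 'I_n -> L) : (forall k, u k != 0) ->
  (forall j k, j != k -> ell2_dot (u j) (u k) = 0) -> lin_indep u.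
Proof.
move=> u0 uo c cu j; have := @dot_sum_orth _ _ (@ell2_dot R I) n c u j.
rewrite /= cu => /(_ (fun k kj => uo k j kj)).
have -> : ell2_dot 0 (u j) = 0 := linear0l (@ell2_dot R I) (u j).
move=> /esym/eqP; rewrite mulf_eq0 ell2_dotE => /orP[/eqP //|].
by rewrite eq_complex /= eqxx andbT sqn_eq0 (negbTE (u0 j)).
Qed.

Lemma esum_single (f : I -> \bar R) j : (forall i, (0 <= f i)%E) ->
  (forall i, i != j -> f i = 0%E) -> (\esum_(i in [set: I]) f i = f j)%E.
Proof.
move=> f0 fj; rewrite -(esum_set1 (f0 j)) [RHS]esum_mkcond; apply: eq_esum => i _.
by case: ifPn => //; rewrite notin_setE => /eqP/fj.
Qed.

Lemma rsum_single (f : I -> R) j : (forall i, i != j -> f i = 0) ->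
  rsum f = f j.
Proof.
move=> fj; rewrite /rsum !(@esum_single _ j) /=.
- case: (leP 0 (f j)) => h; first by rewrite max_r ?oppr_le0// subr0.
  by rewrite max_l ?oppr_ge0 1?ltW// sub0r opprK.
- by move=> i; rewrite lee_fin le_max lexx orbT.
- by move=> i /fj ->; rewrite oppr0 maxxx.
- by move=> i; rewrite lee_fin le_max lexx orbT.
- by move=> i /fj ->; rewrite maxxx.
Qed.

Lemma csum_single (f : I -> R[i]) j : (forall i, i != j -> f i = 0) ->
  csum f = f j.
Proof.
move=> fj; rewrite /csum !(@rsum_single _ j).
- by case: (f j).
- by move=> i /fj ->.
- by move=> i /fj ->.
Qed.

Lemma basis_square_summable (j : I) :
  (fun i => (i == j)%:R : R[i]) \in @square_summable R I.
Proof.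
apply/asboolP; rewrite (@esum_single _ j); first exact: ltry.
  by move=> i; rewrite lee_fin Re_normsqr_ge0.
by move=> i /negbTE ->; rewrite normr0 expr0n.
Qed.

Definition ell2_basis (j : I) : L := Ell2 (basis_square_summable j).

Lemma ell2_dot_basis a j : ell2_dot a (ell2_basis j) = a j.
Proof.
rewrite /ell2_dot (@csum_single _ j) /=; first by rewrite eqxx rmorph_nat mulr1.
by move=> i /negbTE ->; rewrite rmorph0 mulr0.
Qed.

Lemma sqn_basis j : sqn (ell2_basis j) = 1.
Proof. by apply: complexI; rewrite -ell2_dotE ell2_dot_basis /= eqxx. Qed.

(** The coordinate expansion reduces measurability of a square norm to that of coordinates. *)
Lemma sqnE a : (sqn a)%:E = \esum_(i in [set: I]) (complex.Re (`|a i| ^+ 2))%:E.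
Proof.
have fin : (\esum_(i in [set: I]) (complex.Re (`|a i| ^+ 2))%:E < +oo)%E.
  exact: asboolW (ell2P a).
have E : ell2_dot a a = csum (fun i => `|a i| ^+ 2).
  by congr csum; apply/funext => i; rewrite normCK.
have -> : sqn a = rsum (fun i => complex.Re (`|a i| ^+ 2)).
  by rewrite -[LHS]/(complex.Re (sqn a)%:C%C) -ell2_dotE E.
have ge0 i : 0 <= complex.Re (`|a i| ^+ 2) by exact: Re_normsqr_ge0.
rewrite rsum_ge0E ?fineK//.
  by rewrite ge0_fin_numE// esum_ge0// => i _; rewrite lee_fin.
apply: le_lt_trans fin; apply: le_esum => i _.
by rewrite /comp gee0_abs ?lee_fin.
Qed.

Lemma ell2_sumE n (c : 'I_n -> R[i]) (u : 'I_n -> L) i :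
  (\sum_k c k *: u k : L) i = \sum_k c k * u k i.
Proof. by elim/big_rec2: _ => // k x y _ <-. Qed.

Lemma ell2P0 a : (forall i, a i = 0) -> a = 0.
Proof. by move=> a0; apply/val_inj/funext. Qed.

End ell2_facts.

(** * Dimension as a supremum of sizes of independent families *)

Section dimension.
Variables (R : realType) (E : normedModType R[i]).

Lemma edim_ge n (V : set E) (u : 'I_n -> E) :
  lin_indep u -> (forall k, V (u k)) -> (n%:R%:E <= edim V)%E.
Proof. by move=> iu uV; apply: ereal_sup_ubound => /=; exists n => //; exists u. Qed.

Lemma edim_le (V : set E) (c : \bar R) :
  (forall n (u : 'I_n -> E), lin_indep u -> (forall k, V (u k)) ->
    (n%:R%:E <= c)%E) -> (edim V <= c)%E.
Proof. by move=> h; apply: ge_ereal_sup => _ [n [u iu uV] <-]; exact: (h n u). Qed.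

Lemma edim_ge0 (V : set E) : (0 <= edim V)%E.
Proof.
have u0 : 'I_0 -> E by case.
by apply: (@edim_ge 0 V u0) => [c _|] [].
Qed.

End dimension.

(** * Vanishing coordinates and orthogonal projections *)

Section sequence_coordinates.
Variables (R : realType) (I : choiceType) (enum : nat -> I).
Hypothesis enum_surj : forall i, exists n, enum n = i.
Local Notation L := (ell2 R I).

(** If n < m, the m by n matrix of the first n coordinates has a nonzero left kernel vector; as the
    other coordinates vanish, it is a linear relation among the u k. *)
Lemma lin_indep_size_le m n (u : 'I_m -> L) : lin_indep u ->
  (forall k i, (n <= i)%N -> u k (enum i) = 0) -> (m <= n)%N.
Proof.
move=> iu u0; rewrite leqNgt; apply/negP => nm.
pose M : 'M[R[i]]_(m, n) := \matrix_(k, i) u k (enum i).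
have : kermx M != 0.
  rewrite kermx_eq0 -row_leq_rank -ltnNge.
  exact: leq_ltn_trans (rank_leq_col M) nm.
move=> /rowV0Pn[c /sub_kermxP cM c0]; move/negP: c0; apply; apply/eqP.
apply/rowP => k; rewrite mxE; apply: (iu (fun k => c 0 k)).
apply: ell2P0 => x; have [i <-] := enum_surj x; rewrite ell2_sumE.
have [ni|ni] := leqP n i.
  by rewrite big1// => j _; rewrite u0// mulr0.
have /rowP/(_ (Ordinal ni)) := cM; rewrite !mxE => cMi.
by rewrite -[RHS]cMi; apply: eq_bigr => j _; rewrite mxE.
Qed.

(** With e the basis vector, the square norm of P e equals (e, P e), the conjugate of the j-th
    coordinate of P e. Thus P e = 0 and e is orthogonal to V. *)
Lemma orth_proj_basis_eq0 (V : set L) (P : L -> L) (j : I) (a : L) :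
  orth_proj (@ell2_dot R I) V P -> P (ell2_basis R j) j = 0 -> V a -> a j = 0.
Proof.
move=> PV Pj0 Va; set e := ell2_basis R j.
have [VPe ePo] := PV e.
have Pe0 : P e = 0.
  apply/eqP; rewrite -sqn_eq0 -(inj_eq (@complexI R)) -ell2_dotE.
  have : ell2_dot (e - P e) (P e) = 0 := ePo _ VPe.
  have -> : ell2_dot (e - P e) (P e) = ell2_dot e (P e) - ell2_dot (P e) (P e).
    exact: (linearBl (@ell2_dot R I)).
  move=> /subr0_eq <-.
  by rewrite ell2_dotC ell2_dot_basis Pj0 rmorph0.
have : ell2_dot (e - P e) a = 0 := ePo _ Va.
rewrite Pe0 subr0 ell2_dotC.
by rewrite ell2_dot_basis => /eqP; rewrite conjC_eq0 => /eqP.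
Qed.

Lemma sqn_orth_proj_le (V : set L) (P : L -> L) (a : L) :
  orth_proj (@ell2_dot R I) V P -> sqn (P a) <= sqn a.
Proof.
move=> /(_ a)[VPa /(_ _ VPa) ao].
have {}ao : ell2_dot (a - P a) (P a) = 0 := ao.
have -> : sqn a = sqn (1 *: (a - P a) + P a) by rewrite scale1r subrK.
rewrite sqnZD ao mulr0 [complex.Re 0]/= (mulr0 2) addr0 lerDr Re_normsqr.
by rewrite mulr_ge0 ?sqn_ge0// addr_ge0// sqr_ge0.
Qed.

End sequence_coordinates.

(** * Multiplicity of a nested sequence of sets *)

Section multiplicity_facts.
Variables (R : realType) (Gam : zmodType).
Local Notation dual := (dual R Gam).
Variables (sigma : nat -> set dual).
Hypothesis sigma_nested : forall i, sigma i.+1 `<=` sigma i.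

Lemma sigma_decr m n : (m <= n)%N -> sigma n `<=` sigma m.
Proof.
move=> /subnK <-; elim: (n - m)%N => // k IH.
by rewrite addSn => chi /sigma_nested; exact: IH.
Qed.

Lemma multiplicity_ge n (chi : dual) :
  (forall i, (i < n)%N -> sigma i chi) -> (n%:R%:E <= multiplicity sigma chi)%E.
Proof.
move=> sn; rewrite /multiplicity.
apply: le_trans (nneseries_lim_ge n _); last first.
  by move=> i _ _; rewrite lee_fin.
rewrite (eq_big_nat _ _ (F2 := fun=> 1%:E)).
  by rewrite sumEFin big_const_nat subn0 iter_addr_0.
by move=> i /andP[_ i_n]; rewrite indicE mem_set//; exact: sn.
Qed.

(** Induction on partial sums: if chi lies in [sigma n], the first n + 1 indicators sum to at most n
    + 1; otherwise the last term is 0. The indices start at 0, hence [n.+1]. *)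
Lemma multiplicity_le (chi : dual) (c : \bar R) : (0 <= c)%E ->
  (forall n, sigma n chi -> (n.+1%:R%:E <= c)%E) ->
  (multiplicity sigma chi <= c)%E.
Proof.
move=> c0 sc; apply: lime_le.
  by apply: is_cvg_nneseries => i _ _; rewrite lee_fin.
apply: nearW => n; rewrite sumEFin.
elim: n => [|n IH]; first by rewrite big_geq.
rewrite big_nat_recr//= indicE; have [sn|sn] := pselect (sigma n chi).
  rewrite (le_trans _ (sc n sn))// lee_fin [leRHS]mulrSr mem_set// lerD2r.
  have le1 i : \1_(sigma i) chi <= (1 : R) by rewrite indicE; case: (_ \in _).
  rewrite (le_trans (ler_sum _ (fun i _ => le1 i)))//.
  by rewrite big_const_nat subn0 iter_addr_0.
by rewrite memNset// addr0.
Qed.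

End multiplicity_facts.

(** * Spectral data of a subrepresentation *)

Section spectral_facts.
Variables (R : realType) (Gam : zmodType) (enum : nat -> Gam).
Hypothesis enum_bij : bijective enum.
Local Notation dual := (dual R Gam).
Local Notation L := (ell2 R Gam).
Implicit Types (mu : {finite_measure set dual -> \bar R}) (F : dual -> L).

Lemma enum_surj x : exists n, enum n = x.
Proof. by case: enum_bij => g _ gK; exists (g x). Qed.

(** Weak measurability makes each coordinate measurable, and the square norm is a countable sum over
    them along [enum]. *)
Lemma measurable_sqn F :
  (forall a : L, cmeasurable (fun chi => ell2_dot (F chi) a)) ->
  measurable_fun [set: dual] (fun chi => (sqn (F chi))%:E).
Proof.
move=> mF; pose h n chi := (complex.Re (`|F chi (enum n)| ^+ 2))%:E.
have -> : (fun chi => (sqn (F chi))%:E) =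
    (fun chi => \sum_(n <oo) h n chi)%E.
  apply/funext => chi; rewrite sqnE nneseries_esumT; last first.
    by move=> n; rewrite lee_fin Re_normsqr_ge0.
  apply: reindex_esum; case: enum_bij => g enumK gK; split => //.
    by move=> i j _ _; exact: (can_inj enumK).
  by move=> x _; exists (g x).
apply: ge0_emeasurable_sum => [n chi _ _|n _].
  by rewrite lee_fin Re_normsqr_ge0.
apply/measurable_EFinP; have [mRe mIm] := mF (ell2_basis R (enum n)).
under eq_fun do rewrite Re_normsqr -(ell2_dot_basis (F _)).
by apply: measurable_funD; apply: measurable_funX.
Qed.

Lemma L2_measurable mu F : L2 mu F ->
  measurable_fun [set: dual] (fun chi => (sqn (F chi))%:E).
Proof. by case=> mF _; exact: measurable_sqn. Qed.

Lemma L2_integrable mu F : L2 mu F ->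
  mu.-integrable [set: dual] (fun chi => (sqn (F chi))%:E).
Proof.
move=> LF; apply/integrableP; split; first exact: L2_measurable LF.
case: LF => _; congr (_ < _)%E; apply: eq_integral => chi _.
by rewrite gee0_abs// lee_fin sqn_ge0.
Qed.

(** These fields are the test vectors: surjectivity of the spectral transform lifts them to the
    Hilbert space. *)
Lemma direct_sum_indic mu sigma i A : measurable A -> A `<=` sigma i ->
  direct_sum enum mu sigma
    (fun chi => (\1_A chi : R[i]) *: ell2_basis R (enum i)).
Proof.
move=> mA Asi; split; last first.
  move=> j; apply: aeW => chi nsj; rewrite indicE.
  have [Achi|Achi] := pselect (A chi); last by rewrite memNset// scale0r.
  rewrite mem_set// scale1r /=; case: eqP => // /(bij_inj enum_bij) ji.
  by case: nsj; rewrite ji; exact: Asi.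
split.
  move=> a; pose c := ell2_dot (ell2_basis R (enum i)) a.
  have E chi : ell2_dot ((\1_A chi : R[i]) *: ell2_basis R (enum i)) a =
      Complex (\1_A chi * complex.Re c) (\1_A chi * complex.Im c).
    have -> : ell2_dot ((\1_A chi : R[i]) *: ell2_basis R (enum i)) a =
      \1_A chi * c := linearZl_LR (@ell2_dot R Gam) a _ _.
    by rewrite !indicE; case: (_ \in _); case: c => x y;
       rewrite /= ?mul1r ?mul0r.
  by split; under eq_fun do rewrite E /=; apply: measurable_funM => //;
     exact: measurable_indic.
apply: (@le_lt_trans _ _ (mu A)); last first.
  by rewrite -ge0_fin_numE//; exact: fin_num_measure.
rewrite -[in leRHS](setIT A) -integral_indic// le_eqVlt; apply/orP; left.
apply/eqP/eq_integral => chi _; rewrite !indicE.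
case: (_ \in _); last by rewrite scale0r normr0 expr0n.
by rewrite scale1r; congr EFin; exact: sqn_basis.
Qed.

Variables (lam : probability dual R).
Variables (H : completeNormedModType R[i]) (dot : {dot H for conjC}).
Hypothesis dot_norm : forall f : H, `|f| ^+ 2 = dot f f.

(* The projections of the spectral measure become multiplications by indicators
   under T, so that the scalar spectral measure of f has density |T f| ^ 2. *)
Lemma spectral_measure (K : set H) rho mu sigma T f :
  spectral_data dot lam enum K rho mu sigma T -> K f ->
  exists2 nu : {finite_measure set dual -> \bar R},
    forall A, measurable A -> nu A = (\int[mu]_(chi in A) (sqn (T f chi))%:E)%E &
    forall x, dot (rho x f) f = cintegral nu (fun chi => chi x).
Proof.
move=> [_ _ _ _ [Tmem _ Tnorm _] _ [p [[pP _ _ _] prho] pT]] Kf.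
have [nu nuE nurho] := prho f Kf; exists nu => // A mA.
have [pK _ pid psym] := pP A mA.
have mT g : K g -> measurable_fun [set: dual] (fun chi => (sqn (T g chi))%:E).
  by move=> /Tmem[/L2_measurable].
rewrite nuE//.
have -> : dot (p A f) f = `|p A f| ^+ 2.
  by rewrite dot_norm -[in LHS](pid f Kf) psym//; exact: pK.
rewrite -(Tnorm _ (pK f Kf)) [RHS]integral_mkcond.
apply: ae_eq_integral => //.
- exact: mT (pK f Kf).
- apply/(measurable_restrictT _ mA); apply: measurable_funTS; exact: mT.
- apply: filterS (pT A f mA Kf) => chi pTchi _; rewrite pTchi patchE indicE.
  case: ifPn => _; first by rewrite scale1r.
  by rewrite scale0r normr0 expr0n.
Qed.

(** * Comparison of the two spectral pictures of a vector of [V] *)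

Variables (V : set H) (rho : Gam -> H -> H).
Variables (mu mu' : {finite_measure set dual -> \bar R}).
Variables (sigma sigma' : nat -> set dual) (T T' : H -> dual -> L).
Hypothesis V_closed : closed_subspace V.
Hypothesis rho_data : spectral_data dot lam enum [set: H] rho mu sigma T.
Hypothesis rho'_data : spectral_data dot lam enum V rho mu' sigma' T'.

Let T_L2 f : L2 mu (T f).
Proof. by case: (uo_mem (sd_unitary rho_data) (I : [set: H] f)). Qed.

Let T'_L2 f : V f -> L2 mu' (T' f).
Proof. by move=> /(uo_mem (sd_unitary rho'_data))[]. Qed.

(** Both sides are measures in A with Fourier coefficients (rho x f, f). Every later passage between
    mu and mu' rests on this identity. *)
Lemma sub_spectral_mass f A : V f -> measurable A ->
  (\int[mu]_(chi in A) (sqn (T f chi))%:E =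
   \int[mu']_(chi in A) (sqn (T' f chi))%:E)%E.
Proof.
move=> Vf mA; have [nu nuE nuF] := spectral_measure rho_data (I : [set: H] f).
have [nu' nu'E nu'F] := spectral_measure rho'_data Vf.
rewrite -nuE// -nu'E//; apply: (fourier_unique enum_surj) => // x.
by rewrite -nuF -nu'F.
Qed.

(** The densities of f and of k times h have equal mu'-integrals over every measurable set, hence
    equal mu-integrals, and so coincide mu-a.e. *)
Lemma sub_sqn_scale f h (k : R) : V f -> V h -> 0 <= k ->
  {ae mu', forall chi, sqn (T' f chi) = k * sqn (T' h chi)} ->
  {ae mu, forall chi, sqn (T f chi) = k * sqn (T h chi)}.
Proof.
move=> Vf Vh k0 fh.
have kE (m : {finite_measure set dual -> \bar R}) F A : L2 m F -> measurable A ->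
    (\int[m]_(chi in A) (k * sqn (F chi))%:E =
     k%:E * \int[m]_(chi in A) (sqn (F chi))%:E)%E.
  move=> LF mA; under eq_integral do rewrite EFinM.
  rewrite ge0_integralZl_EFin// => [chi _|]; first by rewrite lee_fin sqn_ge0.
  by apply: measurable_funTS; exact: L2_measurable LF.
have mk (m : {finite_measure set dual -> \bar R}) F : L2 m F ->
    measurable_fun [set: dual] (fun chi => (k * sqn (F chi))%:E).
  move=> /L2_measurable mF; under eq_fun do rewrite EFinM.
  exact: measurable_funeM.
have : ae_eq mu setT (fun chi => (sqn (T f chi))%:E)
    (fun chi => (k * sqn (T h chi))%:E).
  apply: integral_ae_eq => //; [exact: L2_integrable|exact: mk|].
  move=> A _ mA; rewrite kE// !sub_spectral_mass// -kE//; last exact: T'_L2.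
  apply: ae_eq_integral => //.
  - apply: measurable_funTS; exact: L2_measurable (T'_L2 Vf).
  - apply: measurable_funTS; exact: mk (T'_L2 Vh).
  - by apply: filterS fh => chi -> .
by apply: filterS => chi /(_ I)[].
Qed.

(** The mass of f over A vanishes for mu, hence for mu', and a nonnegative function with zero
    integral is zero a.e. *)
Lemma sub_sqn_eq0 f A : V f -> measurable A ->
  {ae mu, forall chi, A chi -> sqn (T f chi) = 0} ->
  {ae mu', forall chi, A chi -> sqn (T' f chi) = 0}.
Proof.
move=> Vf mA f0.
have mT' : measurable_fun A (fun chi => (sqn (T' f chi))%:E).
  by apply: measurable_funTS; exact: L2_measurable (T'_L2 Vf).
have : (\int[mu']_(chi in A) `|(sqn (T' f chi))%:E| = 0)%E.
  under eq_integral do rewrite gee0_abs ?lee_fin ?sqn_ge0//.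
  rewrite -sub_spectral_mass// -(integral0 mu A).
  apply: ae_eq_integral => //.
    by apply: measurable_funTS; exact: L2_measurable (T_L2 f).
  by apply: filterS f0 => chi h /h ->.
move=> /(ae_eq_integral_abs _ mA mT'); apply: filterS => chi h /h.
by case.
Qed.

Lemma sub_onto i A : measurable A -> A `<=` sigma' i ->
  exists2 f, V f & {ae mu', forall chi,
    T' f chi = (\1_A chi : R[i]) *: ell2_basis R (enum i)}.
Proof.
move=> mA Asi.
have [f Vf fE] := uo_onto (sd_unitary rho'_data) (direct_sum_indic mu' mA Asi).
by exists f => //; apply: filterS fE => chi ->.
Qed.

(** Absolute continuity of mu' with respect to mu. Lift the indicator of [sigma' 0] to f: then
    [T' f] is a unit vector mu'-a.e., whereas it vanishes mu'-a.e. on any mu-null set. *)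
Lemma sub_ae (P : dual -> Prop) :
  {ae mu, forall chi, P chi} -> {ae mu', forall chi, P chi}.
Proof.
move=> [N [mN N0 PN]].
have [f Vf fE] := @sub_onto 0 _ (sd_measurable rho'_data 0) (@subset_refl _ _).
(* This holds for any f: exceptions lie in N, which is mu-null. *)
have /sub_sqn_eq0 : {ae mu, forall chi, N chi -> sqn (T f chi) = 0}.
  by exists N; split => // chi /= /not_implyP[].
move=> /(_ Vf mN) f0.
have s0 : {ae mu', forall chi, sigma' 0%N chi}.
  exists (~` sigma' 0%N); split => //; last exact: (sd_support rho'_data).
  by apply: measurableC; exact: (sd_measurable rho'_data).
apply: filterS3 f0 fE s0 => chi f0 fE s0; apply: contrapT => /PN /f0.
rewrite fE indicE mem_set// scale1r sqn_basis => /eqP.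
by rewrite oner_eq0.
Qed.

(** Under [T'] the vectors are orthonormal over [sigma' n] and zero elsewhere. The resulting
    proportionalities of square norms transfer to [T], and polarization recovers orthogonality
    there. *)
Lemma sub_lin_indep n (f : 'I_n.+1 -> H) :
  (forall k, V (f k)) ->
  (forall k, {ae mu', forall chi,
    T' (f k) chi = (\1_(sigma' n) chi : R[i]) *: ell2_basis R (enum k)}) ->
  {ae mu', forall chi, sigma' n chi -> lin_indep (fun k => T (f k) chi)}.
Proof.
move=> Vf fE; pose c chi : R[i] := \1_(sigma' n) chi.
have [_ VP _] := V_closed.
have Vc a j k : V (a *: f j + f k) by apply: VP.
have sqn1 k : {ae mu, forall chi, sqn (T (f k) chi) = 1 * sqn (T (f ord0) chi)}.
  apply: sub_sqn_scale => //; apply: filterS2 (fE k) (fE ord0) => chi -> ->.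
  rewrite indicE; case: (_ \in _); first by rewrite !scale1r !sqn_basis mul1r.
  by rewrite !scale0r mul1r.
(* To be used with a = 1 and a = i, as [ell2_orth] requires. *)
have sqn2 a j k : `|a| = 1 -> j != k -> {ae mu, forall chi,
    sqn (a *: T (f j) chi + T (f k) chi) = 2 * sqn (T (f ord0) chi)}.
  move=> a1 jk.
  have l := uo_linear (sd_unitary rho_data) a (I : setT (f j)) (I : setT (f k)).
  have l' := uo_linear (sd_unitary rho'_data) a (Vf j) (Vf k).
  apply: filterS2 l _ => [chi <-|]; first exact.
  apply: sub_sqn_scale => //; apply: filterS2 l' _ => [chi ->|]; first exact.
  apply: filterS3 (fE j) (fE k) (fE ord0) => chi -> -> ->.
  rewrite indicE; case: (_ \in _); last first.
    rewrite !scale0r scaler0 addr0.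
    by rewrite (eqP (_ : sqn (0 : L) == 0)) ?sqn_eq0// mulr0.
  have dot0 : ell2_dot (ell2_basis R (enum j)) (ell2_basis R (enum k)) = 0.
    rewrite ell2_dot_basis /= (_ : enum k == enum j = false)//.
    apply/negbTE/eqP => /(bij_inj enum_bij)/val_inj kj.
    by move: jk; rewrite kj eqxx.
  by rewrite !scale1r sqnZD !sqn_basis dot0 a1 expr1n mulr0 /= mulr0 addr0 !mulr1.
have {}sqn1 : {ae mu, forall chi k,
    sqn (T (f k) chi) = sqn (T (f ord0) chi)}.
  by apply: filter_forall => k; apply: filterS (sqn1 k) => chi ->; rewrite mul1r.
have orth : {ae mu, forall chi j k, j != k ->
    ell2_dot (T (f j) chi) (T (f k) chi) = 0}.
  apply: filter_forall => j; apply: filter_forall => k.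
  have [->|jk] := eqVneq j k; first exact: aeW.
  have i1 : `|'i%C| = 1 :> R[i].
    by rewrite normc_def /= expr0n expr1n add0r sqrtr1.
  apply: filterS3 (sqn2 1 j k (normr1 _) jk) (sqn2 'i%C j k i1 jk) sqn1.
  move=> chi h1 h2 h _; rewrite scale1r in h1.
  exact: ell2_orth (h j) (h k) h1 h2.
(* Since [T (f ord0)] vanishes on Z, so does [T' (f ord0)] mu'-a.e.; being a unit vector over
   [sigma' n], it forces Z to miss [sigma' n] up to a mu'-null set. *)
pose Z := [set chi | sqn (T (f ord0) chi) = 0].
have mZ : measurable Z.
  rewrite (_ : Z = [set: dual] `&`
      (fun chi => (sqn (T (f ord0) chi))%:E) @^-1` [set 0%E]).
    by apply: (L2_measurable (T_L2 (f ord0))) => //; exact: emeasurable_set1.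
  by rewrite setTI; apply/seteqP; split => chi /= => [->|[]].
have nz : {ae mu', forall chi, sigma' n chi -> ~ Z chi}.
  have := @sub_sqn_eq0 (f ord0) Z (Vf _) mZ (aeW _ (fun _ h => h)).
  apply: filterS2 (fE ord0) => chi -> h sn /h.
  rewrite indicE mem_set// scale1r sqn_basis => /eqP.
  by rewrite oner_eq0.
apply: filterS3 nz (sub_ae sqn1) (sub_ae orth) => chi nz s1 o /nz Z0.
apply: lin_indep_orth => // k; apply/negP => /eqP k0; apply: Z0.
by rewrite /Z /= -(s1 k) k0; apply/eqP; rewrite sqn_eq0.
Qed.

(** * Range functions and the dimension count *)

Variables (J J' : dual -> set L).
Hypothesis J_V : range_function_of mu T V J.
Hypothesis J'_V : range_function_of mu' T' V J'.

Lemma sub_edim_ge n :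
  {ae mu', forall chi, sigma' n chi -> (n.+1%:R%:E <= edim (J chi))%E}.
Proof.
have /choice[f fP] : forall k : 'I_n.+1, exists f, V f /\
    {ae mu', forall chi,
      T' f chi = (\1_(sigma' n) chi : R[i]) *: ell2_basis R (enum k)}.
  (* Nesting makes the indicator of [sigma' n] admissible in each coordinate k <= n, so all n + 1
     vectors live over the same set. *)
  move=> k; have ns := sigma_decr (sd_nested rho'_data) (leq_ord k).
  have [f Vf fE] := sub_onto (sd_measurable rho'_data n) ns.
  by exists f; split.
have fJ : {ae mu, forall chi k, J chi (T (f k) chi)}.
  apply: filter_forall => k; have [_ JP] := J_V.
  have /JP[] // : L2 mu (T (f k)) /\ exists2 g, V g &
      {ae mu, forall chi, T (f k) chi = T g chi}.
  split; first exact: T_L2.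
  by exists (f k); [exact: (fP k).1|exact: aeW].
have := sub_lin_indep (fun k => (fP k).1) (fun k => (fP k).2).
apply: filterS2 (sub_ae fJ) => chi fJchi li sn.
exact: edim_ge (li sn) fJchi.
Qed.

Lemma sub_basis_mem i :
  {ae mu', forall chi, sigma' i chi -> J' chi (ell2_basis R (enum i))}.
Proof.
have mi := sd_measurable rho'_data i.
have /= [f Vf fE] := sub_onto mi (@subset_refl _ _).
have [_ /(_ (T' f))[_ JP]] := J'_V.
have [//|_] := JP.
  by split; [exact: T'_L2|exists f => //; exact: aeW].
apply: filterS2 fE => chi -> + si.
by rewrite indicE mem_set// scale1r.
Qed.

(** The projected basis vector is a square integrable section of [J'], hence some [T' f] in the
    direct sum, so its i-th coordinate vanishes off [sigma' i]. Working with the projection gives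
    one null set valid for all a simultaneously. *)
Lemma sub_coord_eq0 i : {ae mu', forall chi, ~ sigma' i chi ->
  forall a : L, J' chi a -> a (enum i) = 0}.
Proof.
have [[_ [P PJ mP]] JP] := J'_V.
pose F chi := P chi (ell2_basis R (enum i)).
have LF : L2 mu' F.
  split; first by move=> a; exact: mP.
  apply: (@le_lt_trans _ _ (\int[mu']_chi (cst 1%E chi))%E); last first.
    rewrite integral_cst// mul1e -ge0_fin_numE//; exact: fin_num_measure.
  apply: ge0_le_integral => //.
  - by move=> chi _; rewrite lee_fin sqn_ge0.
  - by apply: measurable_sqn => a; exact: mP.
  - by move=> chi _; rewrite lee_fin -(sqn_basis R (enum i)); exact: sqn_orth_proj_le.
have /JP[_ [f Vf fE]] : range_space mu' J' F.
  by split => //; apply: aeW => chi; exact: (PJ chi _).1.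
have [_ /(_ i)] := uo_mem (sd_unitary rho'_data) Vf.
apply: filterS2 fE => chi <- ns nsi a Ja.
by apply: (orth_proj_basis_eq0 (PJ chi)) => //; exact: ns.
Qed.

Lemma sub_multiplicity : {ae mu', forall chi,
  multiplicity sigma' chi = edim (J' chi) /\
  (edim (J' chi) <= edim (J chi))%E}.
Proof.
have nest := sd_nested rho'_data.
apply: filterS3 (ae_foralln sub_edim_ge) (ae_foralln sub_basis_mem)
  (ae_foralln sub_coord_eq0).
move=> chi dimJ memJ' coordJ'.
have E : multiplicity sigma' chi = edim (J' chi).
  apply/eqP; rewrite eq_le; apply/andP; split.
    apply: multiplicity_le => [|n sn]; first exact: edim_ge0.
    apply: (@edim_ge _ _ n.+1 _ (fun k : 'I_n.+1 => ell2_basis R (enum k))).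
      apply: lin_indep_orth.
        by move=> k; rewrite -sqn_eq0 sqn_basis oner_eq0.
      move=> j k jk; rewrite ell2_dot_basis /= (_ : enum k == enum j = false)//.
      apply/negbTE/eqP => /(bij_inj enum_bij)/val_inj kj.
      by move: jk; rewrite kj eqxx.
    move=> k; apply: memJ'; apply: sigma_decr sn => //; exact: leq_ord.
  (* If chi missed [sigma' i] for some i < m, nesting would kill all coordinates from i on, leaving
     room for at most i independent vectors. *)
  apply: edim_le => m u li uJ'; apply: multiplicity_ge => i im.
  apply: contrapT => nsi; have : (m <= i)%N; last by rewrite leqNgt im.
  apply: (lin_indep_size_le enum_surj li) => k j ij.
  apply: coordJ' (uJ' k) => /(sigma_decr nest ij); exact: nsi.
(* The inequality is proved for the multiplicity, where the bounds [n.+1 <= edim (J chi)] over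
   [sigma' n] apply directly. *)
split => //; rewrite -E.
by apply: multiplicity_le => [|n]; [exact: edim_ge0|exact: dimJ].
Qed.

End spectral_facts.

Theorem proposition5p6 (R : realType)
    (G : topologicalZmodType) (S : zmodClosed G)
    (G_second_countable : @second_countable G)
    (G_locally_compact : locally_compact [set: G])
    (G_hausdorff : hausdorff_space G)
    (Gam_closed : closed [set x : G | x \in S])
    (Gam_countable : countable [set x : G | x \in S])
    (Gam_discrete : [set x : G | x \in S] `<=` isolated [set x : G | x \in S])
    (alpha : {additive subgrp S -> subgrp S})
    (alpha_inj : injective alpha)
    (N : nat) (N_gt1 : (1 < N)%N)
    (alpha_index : (cosets (range alpha) #= `I_N)%card)
    (lam : probability (dual R (subgrp S)) R)
    (lam_haar : normalized_haar lam)
    (alpha_ergodic : ergodic lam (dual_endo alpha))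
    (enum : nat -> subgrp S) (enum_bij : bijective enum)
    (H : completeNormedModType R[i]) (dot : {dot H for conjC})
    (dot_norm : forall f : H, `|f| ^+ 2 = dot f f)
    (H_separable : exists2 D : set H, countable D & dense D)
    (pi : subgrp S -> H -> H)
    (pi_unitary : unitary_rep dot [set: H] pi)
    (mu : {finite_measure set (dual R (subgrp S)) -> \bar R})
    (sigma : nat -> set (dual R (subgrp S)))
    (T : H -> dual R (subgrp S) -> ell2 R (subgrp S))
    (pi_data : spectral_data dot lam enum [set: H] pi mu sigma T)
    (mu_ac : mu `<< lam)
    (V : set H) (V_closed : closed_subspace V)
    (V_invariant : forall x f, V f -> V (pi x f))
    (J : dual R (subgrp S) -> set (ell2 R (subgrp S)))
    (J_V : range_function_of mu T V J)
    (mu' : {finite_measure set (dual R (subgrp S)) -> \bar R})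
    (sigma' : nat -> set (dual R (subgrp S)))
    (T' : H -> dual R (subgrp S) -> ell2 R (subgrp S))
    (pi'_data : spectral_data dot lam enum V pi mu' sigma' T')
    (J' : dual R (subgrp S) -> set (ell2 R (subgrp S)))
    (J'_V : range_function_of mu' T' V J') :
  {ae mu', forall chi,
    multiplicity sigma' chi = edim (J' chi) /\
    (edim (J' chi) <= edim (J chi))%E}.
Proof.
exact: (sub_multiplicity enum_bij dot_norm V_closed pi_data pi'_data J_V J'_V).
Qed.
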